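(* (1) Every scattered metrizable space $X$ has a compactification $K$ that is scattered and hereditarily paracompact. (2) Every scattered hereditarily paracompact compact Hausdorff space is uniform Eberlein. (3) A compact Hausdorff space $X$ is scattered and hereditarily paracompact if and only if $X$ belongs to the class $\mathcal A$.
   Context: A topological space is scattered if each nonempty subspace has an isolated point. A compact space is uniform Eberlein if it is homeomorphic to a compact subset of a Hilbert space endowed with its weak topology. A compactification of $X$ is a compact Hausdorff space containing $X$ as a dense subspace. For a locally compact Hausdorff space $Y$, an Aleksandrov compactification of $Y$ is a compactification $\overline Y$ of $Y$ with $|\overline Y\setminus Y|\le 1$ (so if $Y$ is compact it is $Y$ itself). The class $\mathcal A$ is the smallest class of compact spaces that contains the empty space and the one-point space and is closed under taking the Aleksandrov compactification of a topological sum $\bigoplus_{i\in I}K_i$ of any family $\{K_i\}_{i\in I}$ of spaces from $\mathcal A$. *)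

(* Defs.v *)
From Stdlib Require Import Reals List Classical FunctionalExtensionality PropExtensionality.
Open Scope R_scope.

Record Top := {
  carrier :> Type;
  open : (carrier -> Prop) -> Prop;
  open_full : open (fun _ => True);
  open_inter : forall U V, open U -> open V -> open (fun x => U x /\ V x);
  open_union : forall F : (carrier -> Prop) -> Prop,
      (forall U, F U -> open U) -> open (fun x => exists U, F U /\ U x)
}.
Arguments open {t} _.

Definition sub_open (X : Top) (A : X -> Prop) (V : {x : X | A x} -> Prop) : Prop :=
  exists U, open U /\ forall y, V y <-> U (proj1_sig y).

Lemma sub_open_full (X : Top) A : sub_open X A (fun _ => True).
Proof. exists (fun _ => True); split; [apply open_full | tauto]. Qed.

Lemma sub_open_inter (X : Top) A U V :
  sub_open X A U -> sub_open X A V -> sub_open X A (fun x => U x /\ V x).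
Proof.
  intros [U' [HU EU]] [V' [HV EV]]. exists (fun x => U' x /\ V' x).
  split; [now apply open_inter|]. intros y; rewrite EU, EV; tauto.
Qed.

Lemma sub_open_union (X : Top) A (F : ({x : X | A x} -> Prop) -> Prop) :
  (forall U, F U -> sub_open X A U) ->
  sub_open X A (fun x => exists U, F U /\ U x).
Proof.
  intros HF.
  exists (fun x => exists W, (open W /\ exists V, F V /\ forall y, V y <-> W (proj1_sig y)) /\ W x).
  split.
  - apply open_union. intros W [HW _]; exact HW.
  - intros y; split.
    + intros [V [FV Vy]]. destruct (HF V FV) as [W [HW EW]].
      exists W; split; [split; [exact HW | exists V; split; assumption] | now apply EW].
    + intros [W [[_ [V [FV EV]]] Wy]]. exists V; split; [exact FV | now apply EV].
Qed.

Definition subspace (X : Top) (A : X -> Prop) : Top :=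
  {| carrier := {x : X | A x}; open := sub_open X A;
     open_full := sub_open_full X A; open_inter := sub_open_inter X A;
     open_union := sub_open_union X A |}.

Definition sum_open (I : Type) (K : I -> Top) (U : {i : I & carrier (K i)} -> Prop) : Prop :=
  forall i, open (fun x : K i => U (existT _ i x)).

Lemma sum_open_full (I : Type) (K : I -> Top) : sum_open I K (fun _ => True).
Proof. intros i; apply open_full. Qed.

Lemma sum_open_inter (I : Type) (K : I -> Top) U V :
  sum_open I K U -> sum_open I K V -> sum_open I K (fun x => U x /\ V x).
Proof. intros HU HV i; now apply open_inter. Qed.

Lemma open_ext (X : Top) (U V : X -> Prop) :
  (forall x, U x <-> V x) -> open U -> open V.
Proof.
  intros E HU. replace V with U; [exact HU|].
  apply functional_extensionality; intros x; apply propositional_extensionality; apply E.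
Qed.

Lemma sum_open_union (I : Type) (K : I -> Top) (F : ({i : I & carrier (K i)} -> Prop) -> Prop) :
  (forall U, F U -> sum_open I K U) -> sum_open I K (fun x => exists U, F U /\ U x).
Proof.
  intros HF i.
  eapply open_ext;
    [| apply (open_union (K i) (fun W => exists U, F U /\ forall x, W x <-> U (existT _ i x)))].
  - intros x; split.
    + intros [W [[U [FU EU]] Wx]]. exists U; split; [exact FU | now apply EU].
    + intros [U [FU Ux]]. exists (fun x => U (existT _ i x)); split; [exists U; split; [exact FU | tauto] | exact Ux].
  - intros W [U [FU EU]]. eapply open_ext; [| apply (HF U FU i)]. intros x; symmetry; apply EU.
Qed.

Definition top_sum (I : Type) (K : I -> Top) : Top :=
  {| carrier := {i : I & carrier (K i)}; open := sum_open I K;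
     open_full := sum_open_full I K; open_inter := sum_open_inter I K;
     open_union := sum_open_union I K |}.

Definition hausdorff (X : Top) : Prop :=
  forall x y : X, x <> y -> exists U V, open U /\ open V /\ U x /\ V y /\
    forall z, ~ (U z /\ V z).

Definition compact (X : Top) : Prop :=
  forall (I : Type) (U : I -> X -> Prop), (forall i, open (U i)) ->
    (forall x, exists i, U i x) ->
    exists l : list I, forall x, exists i, In i l /\ U i x.

Definition scattered (X : Top) : Prop :=
  forall A : X -> Prop, (exists x, A x) ->
    exists x, A x /\ exists U, open U /\ U x /\ forall y, A y -> U y -> y = x.

(* paracompact: every open cover has a locally finite open refinement
   (Hausdorffness is not built in) *)
Definition locally_finite (X : Top) (J : Type) (V : J -> X -> Prop) : Prop :=
  forall x : X, exists W, open W /\ W x /\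
    exists l : list J, forall j, (exists y, W y /\ V j y) -> In j l.

Definition paracompact (X : Top) : Prop :=
  forall (I : Type) (U : I -> X -> Prop), (forall i, open (U i)) ->
    (forall x, exists i, U i x) ->
    exists (J : Type) (V : J -> X -> Prop),
      (forall j, open (V j)) /\ (forall x, exists j, V j x) /\
      (forall j, exists i, forall x, V j x -> U i x) /\
      locally_finite X J V.

Definition hereditarily_paracompact (X : Top) : Prop :=
  forall A : X -> Prop, paracompact (subspace X A).

Definition metrizable (X : Top) : Prop :=
  exists d : X -> X -> R,
    (forall x y, 0 <= d x y) /\ (forall x y, d x y = 0 <-> x = y) /\
    (forall x y, d x y = d y x) /\ (forall x y z, d x z <= d x y + d y z) /\
    (forall U : X -> Prop, open U <->
       forall x, U x -> exists r, 0 < r /\ forall y, d x y < r -> U y).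

Definition continuous (X Y : Top) (f : X -> Y) : Prop :=
  forall V : Y -> Prop, open V -> open (fun x => V (f x)).

Definition homeomorphic (X Y : Top) : Prop :=
  exists (f : X -> Y) (g : Y -> X), continuous X Y f /\ continuous Y X g /\
    (forall x, g (f x) = x) /\ (forall y, f (g y) = y).

Definition embedding (X K : Top) (e : X -> K) : Prop :=
  continuous X K e /\ (forall x y, e x = e y -> x = y) /\
  (forall U : X -> Prop, open U -> exists V : K -> Prop, open V /\ forall x, U x <-> V (e x)).

Definition dense_image (X K : Top) (e : X -> K) : Prop :=
  forall V : K -> Prop, open V -> (exists p, V p) -> exists x, V (e x).

Definition compactification (X K : Top) (e : X -> K) : Prop :=
  compact K /\ hausdorff K /\ embedding X K e /\ dense_image X K e.

Definition aleksandrov_compactification (X K : Top) (e : X -> K) : Prop :=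
  compactification X K e /\
  forall p q : K, (forall x, e x <> p) -> (forall x, e x <> q) -> p = q.

Inductive classA : Top -> Prop :=
| classA_empty : forall X : Top, (X -> False) -> classA X
| classA_point : forall X : Top, (exists x : X, forall y : X, y = x) -> classA X
| classA_alex : forall (I : Type) (K : I -> Top), (forall i, classA (K i)) ->
    forall (X : Top) (e : top_sum I K -> X),
      aleksandrov_compactification (top_sum I K) X e -> classA X.

Record Hilbert := {
  hv :> Type;
  hzero : hv;
  hadd : hv -> hv -> hv;
  hopp : hv -> hv;
  hscal : R -> hv -> hv;
  hinner : hv -> hv -> R;
  hadd_assoc : forall x y z, hadd x (hadd y z) = hadd (hadd x y) z;
  hadd_comm : forall x y, hadd x y = hadd y x;
  hadd_0 : forall x, hadd hzero x = x;
  hadd_opp : forall x, hadd (hopp x) x = hzero;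
  hscal_assoc : forall a b x, hscal a (hscal b x) = hscal (a * b) x;
  hscal_1 : forall x, hscal 1 x = x;
  hscal_distr_R : forall a b x, hscal (a + b) x = hadd (hscal a x) (hscal b x);
  hscal_distr_v : forall a x y, hscal a (hadd x y) = hadd (hscal a x) (hscal a y);
  hinner_sym : forall x y, hinner x y = hinner y x;
  hinner_add : forall x y z, hinner (hadd x y) z = hinner x z + hinner y z;
  hinner_scal : forall a x y, hinner (hscal a x) y = a * hinner x y;
  hinner_pos : forall x, 0 <= hinner x x;
  hinner_def : forall x, hinner x x = 0 -> x = hzero;
  hcomplete : forall u : nat -> hv,
    (forall eps, 0 < eps -> exists N, forall m n, (N <= m)%nat -> (N <= n)%nat ->
        sqrt (hinner (hadd (u m) (hopp (u n))) (hadd (u m) (hopp (u n)))) < eps) ->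
    exists l, forall eps, 0 < eps -> exists N, forall n, (N <= n)%nat ->
        sqrt (hinner (hadd (u n) (hopp l)) (hadd (u n) (hopp l))) < eps
}.

Definition hnorm (H : Hilbert) (x : H) : R := sqrt (hinner H x x).

Definition bounded_linear (H : Hilbert) (f : H -> R) : Prop :=
  (forall x y, f (hadd H x y) = f x + f y) /\
  (forall a x, f (hscal H a x) = a * f x) /\
  exists C, forall x, Rabs (f x) <= C * hnorm H x.

Definition weak_open (H : Hilbert) (U : H -> Prop) : Prop :=
  forall x, U x -> exists l : list ((H -> R) * R),
    (forall p, In p l -> bounded_linear H (fst p) /\ 0 < snd p) /\
    forall y, (forall p, In p l -> Rabs (fst p y - fst p x) < snd p) -> U y.

Lemma weak_open_full (H : Hilbert) : weak_open H (fun _ => True).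
Proof. intros x _; exists nil; split; [intros p [] | tauto]. Qed.

Lemma weak_open_inter (H : Hilbert) U V :
  weak_open H U -> weak_open H V -> weak_open H (fun x => U x /\ V x).
Proof.
  intros HU HV x [Ux Vx].
  destruct (HU x Ux) as [l1 [B1 S1]]; destruct (HV x Vx) as [l2 [B2 S2]].
  exists (l1 ++ l2); split.
  - intros p Hp; apply in_app_or in Hp; destruct Hp; auto.
  - intros y Hy; split; [apply S1 | apply S2]; intros p Hp; apply Hy, in_or_app; auto.
Qed.

Lemma weak_open_union (H : Hilbert) (F : (H -> Prop) -> Prop) :
  (forall U, F U -> weak_open H U) -> weak_open H (fun x => exists U, F U /\ U x).
Proof.
  intros HF x [U [FU Ux]]. destruct (HF U FU x Ux) as [l [B S]].
  exists l; split; [exact B|]. intros y Hy; exists U; split; [exact FU | now apply S].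
Qed.

Definition weak_top (H : Hilbert) : Top :=
  {| carrier := hv H; open := weak_open H;
     open_full := weak_open_full H; open_inter := weak_open_inter H;
     open_union := weak_open_union H |}.

Definition uniform_eberlein (K : Top) : Prop :=
  exists (H : Hilbert) (A : H -> Prop),
    compact (subspace (weak_top H) A) /\ homeomorphic K (subspace (weak_top H) A).

(* Main.v *)
(* A property of points of a scattered space holds everywhere as soon as it spreads from a punctured
   neighborhood of a point to the point itself, because the set of bad points, if nonempty, has an
   isolated point; this replaces induction on the Cantor-Bendixson rank. Moreover, in both settings
   every open cover of an open set W is refined by a partition of W into open sets: in a
   zero-dimensional compactum this follows from paracompactness of W, in a scattered metric space
   from a variant of Stone's theorem.

   For a scattered hereditarily paracompact compactum, partitioning the complement of x in a small
   clopen set C into clopen sets from the class A exhibits C as an Aleksandrov compactification of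
   a sum. Conversely, in such a compactification a neighborhood of the point at infinity contains
   all but finitely many summands, so scatteredness and hereditary paracompactness are inherited.

   A space of the class A has continuous coordinates that separate points and map it into the unit
   ball of some l2: for a sum use halves of the coordinates of the summands and of their indicators.
   On the unit ball a bounded functional is a uniform limit of finite combinations of coordinates,
   so this map is a weak embedding.

   For a scattered metrizable space, the clopen neighborhoods B_n of a point x cut C \ {x} into
   rings, and if the rings embed into compacta K_n then C embeds into the one-point
   compactification of the sum of the K_n, with x going to infinity. *)
From Stdlib Require Import Reals List Permutation Wf_nat Lra Lia.
From Stdlib Require Import Classical ClassicalEpsilon.
From Stdlib Require Import FunctionalExtensionality PropExtensionality ProofIrrelevance Eqdep.
From mathcomp Require wochoice boolp.
Require Import Defs.

(** * Extensionality, choice and well-orderings *)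

Lemma pred_ext (T : Type) (A B : T -> Prop) : (forall x, A x <-> B x) -> A = B.
Proof.
  intros E. apply functional_extensionality; intros x. apply propositional_extensionality, E.
Qed.

Lemma sig_ext (T : Type) (A : T -> Prop) (u v : {x : T | A x}) :
  proj1_sig u = proj1_sig v -> u = v.
Proof.
  destruct u as [x p], v as [y q]; simpl; intros <-. now rewrite (proof_irrelevance _ p q).
Qed.

Lemma dep_choice (I : Type) (B : I -> Type) (P : forall i, B i -> Prop) :
  (forall i, exists b, P i b) -> exists f : forall i, B i, forall i, P i (f i).
Proof.
  intros H. exists (fun i => proj1_sig (constructive_indefinite_description _ (H i))).
  intros i. exact (proj2_sig (constructive_indefinite_description _ (H i))).
Qed.

Lemma choice (A B : Type) (P : A -> B -> Prop) :
  (forall x, exists y, P x y) -> exists f : A -> B, forall x, P x (f x).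
Proof. exact (dep_choice A (fun _ => B) P). Qed.
Arguments choice {A B} P.

Lemma least_nat (P : nat -> Prop) :
  (exists n, P n) -> exists n, P n /\ forall m, (m < n)%nat -> ~ P m.
Proof.
  intros H.
  destruct (dec_inh_nat_subset_has_unique_least_element P (fun n => classic (P n)) H)
    as [n [[Pn L] _]].
  exists n; split; [exact Pn |]. intros m Hm Pm. apply L in Pm. lia.
Qed.

(* The library theorem is about types with boolean equality; [boolp.Peq] transfers it to [Type]. *)
Lemma choice_order (T : Type) : exists lt : T -> T -> Prop,
  (forall P : T -> Prop, (exists x, P x) -> exists x, P x /\ forall y, P y -> ~ lt y x) /\
  (forall x y, x <> y -> lt x y \/ lt y x).
Proof.
  revert T; refine (boolp.Peq _); intros ET; set (T := eqtype.Equality.sort ET).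
  destruct (wochoice.well_ordering_principle ET) as [le Hle].
  assert (Hmin : forall P : T -> Prop, (exists x, P x) ->
    exists m, (P m /\ forall y, P y -> le m y = true) /\
      forall m', P m' /\ (forall y, P y -> le m' y = true) -> m = m').
  { intros P [x Px].
    assert (E : forall y, boolp.asbool (P y) = true <-> P y).
    { intros y. destruct (boolp.asboolP (P y)); easy. }
    destruct (Hle (fun y => boolp.asbool (P y))) as [m [[Am Lm] Um]].
    { exists x. now apply E. }
    exists m. split; [split; [now apply E | intros y Py; apply Lm; now apply E] |].
    intros m' [Pm' Lm']. apply Um. split; [now apply E | intros y Py; apply Lm'; now apply E]. }
  (* Strict precedence is the failure of the reverse weak order, so nothing strictly precedes a
     least element for [le]. *)
  exists (fun x y => le y x = false); split.
  - intros P HP. destruct (Hmin P HP) as [m [[Pm Lm] _]].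
    exists m; split; [exact Pm |]. intros y Py. rewrite (Lm y Py). discriminate.
  - intros x y N. destruct (le y x) eqn:E1; [| now left]. destruct (le x y) eqn:E2; [| now right].
    exfalso.
    assert (Hrefl : forall z, le z z = true).
    { intros z. destruct (Hmin (fun u => u = z)) as [m [[-> Lm] _]]; [now exists z |]. now apply Lm. }
    (* If [x] and [y] weakly precede each other, both are least in the pair, and uniqueness of the
       least element identifies them. *)
    destruct (Hmin (fun z => z = x \/ z = y)) as [m [_ Um]]; [exists x; now left |].
    apply N. transitivity m; [symmetry |]; apply Um; split; auto; intros z [-> | ->]; auto.
Qed.

(** * Open, closed and compact sets *)

Definition closed (X : Top) (A : X -> Prop) : Prop := open (fun x => ~ A x).

Definition clopen (X : Top) (A : X -> Prop) : Prop := open A /\ closed X A.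

Section OpenSets.
Context (X : Top).
Implicit Types (A B U V : X -> Prop).

Lemma open_nbhd U :
  (forall x, U x -> exists O, open O /\ O x /\ forall y, O y -> U y) -> open U.
Proof.
  intros H. eapply open_ext;
    [| apply (open_union X (fun O => open O /\ forall y, O y -> U y)); now intros O [HO _]].
  intros x; split; [intros [O [[_ S] Ox]]; auto |].
  intros Ux. destruct (H x Ux) as [O [HO [Ox S]]]. now exists O.
Qed.

Lemma open_const (P : Prop) : open (fun _ : X => P).
Proof.
  apply open_nbhd. intros x HP. exists (fun _ => True). split; [apply open_full | tauto].
Qed.

Lemma open_ex (I : Type) (U : I -> X -> Prop) :
  (forall i, open (U i)) -> open (fun x => exists i, U i x).
Proof.
  intros H. apply open_nbhd. intros x [i Ux]. exists (U i). split; [apply H |].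
  split; [exact Ux | intros y Uy; now exists i].
Qed.

Lemma open_or U V : open U -> open V -> open (fun x => U x \/ V x).
Proof.
  intros HU HV. apply open_nbhd. intros x [Ux | Vx]; [exists U | exists V]; auto.
Qed.

Lemma open_forall_list (T : Type) (l : list T) (U : T -> X -> Prop) :
  (forall a, In a l -> open (U a)) -> open (fun x => forall a, In a l -> U a x).
Proof.
  induction l as [| a l IH]; intros H.
  - eapply open_ext; [| apply open_full]. intros x; split; [intros _ b [] | tauto].
  - eapply open_ext; [| apply (open_inter X (U a) (fun x => forall b, In b l -> U b x))].
    + intros x; split; [intros [Ua Ul] b [<- | Hb]; auto | intros Hx; split; [apply Hx; now left |]].
      intros b Hb. apply Hx; now right.
    + apply H; now left.
    + apply IH. intros b Hb. apply H; now right.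
Qed.

Lemma clopen_and A B : clopen X A -> clopen X B -> clopen X (fun x => A x /\ B x).
Proof.
  intros [OA CA] [OB CB]. split; [now apply open_inter |].
  eapply open_ext; [| apply (open_or _ _ CA CB)]. intros x; simpl.
  destruct (classic (A x)); tauto.
Qed.

Lemma clopen_not A : clopen X A -> clopen X (fun x => ~ A x).
Proof.
  intros [OA CA]. split; [exact CA |].
  eapply open_ext; [| exact OA]. intros x; split; [tauto | apply NNPP].
Qed.

Lemma clopen_full : clopen X (fun _ => True).
Proof. split; [apply open_full |]. apply (open_const (~ True)). Qed.

Lemma clopen_forall_list (T : Type) (l : list T) (U : T -> X -> Prop) :
  (forall a, In a l -> clopen X (U a)) -> clopen X (fun x => forall a, In a l -> U a x).
Proof.
  intros H. split; [apply open_forall_list; intros a Ha; now apply H |].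
  apply open_nbhd. intros x Hx. apply not_all_ex_not in Hx. destruct Hx as [a Hx].
  exists (fun y => ~ U a y). split; [apply H; tauto |]. split; [tauto |].
  intros y Hy Hn. apply Hy, Hn; tauto.
Qed.

Lemma hausdorff_T1 : hausdorff X -> forall x : X, open (fun y => y <> x).
Proof.
  intros HX x. apply open_nbhd. intros y N.
  destruct (HX y x N) as [U [V [HU [HV [Uy [Vx D]]]]]].
  exists U. split; [exact HU |]. split; [exact Uy |]. intros z Uz ->. now apply (D x).
Qed.

Lemma compact_closed_cover A (I : Type) (U : I -> X -> Prop) :
  compact X -> closed X A -> (forall i, open (U i)) -> (forall x, A x -> exists i, U i x) ->
  exists l, forall x, A x -> exists i, In i l /\ U i x.
Proof.
  intros HX HA HU Hcov.
  (* The complement of [A] joins the cover under the index [None] and is dropped from the finite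
     subcover. *)
  destruct (HX (option I) (fun o => match o with Some i => U i | None => fun x => ~ A x end))
    as [l Hl].
  - intros [i |]; auto.
  - intros x. destruct (classic (A x)) as [Ax | N]; [| now exists None].
    destruct (Hcov x Ax) as [i Ui]. now exists (Some i).
  - exists (flat_map (fun o => match o with Some i => i :: nil | None => nil end) l).
    intros x Ax. destruct (Hl x) as [[i |] [Hi Ui]]; [| easy].
    exists i. split; [| exact Ui]. apply in_flat_map. exists (Some i). simpl; auto.
Qed.

Lemma compact_closed_nbhds A (O : X -> X -> Prop) :
  compact X -> closed X A -> (forall z, A z -> open (O z) /\ O z z) ->
  exists l, (forall z, In z l -> A z) /\ forall x, A x -> exists z, In z l /\ O z x.
Proof.
  intros HX HA HO.
  destruct (compact_closed_cover A {z : X | A z} (fun z => O (proj1_sig z)) HX HA) as [l Hl].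
  - intros [z Az]. now apply HO.
  - intros x Ax. exists (exist _ x Ax). now apply HO.
  - exists (map (@proj1_sig _ _) l). split.
    + intros z Hz. apply in_map_iff in Hz. destruct Hz as [[z' Az] [<- _]]. exact Az.
    + intros x Ax. destruct (Hl x Ax) as [z [Hz Oz]]. exists (proj1_sig z).
      split; [now apply in_map | exact Oz].
Qed.

(** The predicate is the closure of [A], spelled out through neighborhoods. *)
Lemma closure_closed A : closed X (fun x => forall O, open O -> O x -> exists y, O y /\ A y).
Proof.
  apply open_nbhd. intros x Hx.
  apply not_all_ex_not in Hx. destruct Hx as [O HO].
  exists O. split; [tauto |]. split; [tauto |]. intros y Oy Hy.
  apply HO. intros H1 _. now apply Hy.
Qed.

Lemma compact_separate_closed A x :
  compact X -> hausdorff X -> closed X A -> ~ A x ->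
  exists U V, open U /\ open V /\ U x /\ (forall y, A y -> V y) /\ forall y, ~ (U y /\ V y).
Proof.
  intros HX T2 HA Nx.
  destruct (choice (fun z (UV : (X -> Prop) * (X -> Prop)) => A z ->
    open (fst UV) /\ open (snd UV) /\ fst UV x /\ snd UV z /\ forall y, ~ (fst UV y /\ snd UV y)))
    as [F HF].
  { intros z. destruct (classic (A z)) as [Az | N].
    - destruct (T2 x z) as [U [V H]]; [intros ->; contradiction |]. now exists (U, V).
    - now exists (fun _ => True, fun _ => True). }
  destruct (compact_closed_nbhds A (fun z => snd (F z)) HX HA) as [l [Al Hl]].
  { intros z Az. destruct (HF z Az) as [_ [H1 [_ [H2 _]]]]. now split. }
  exists (fun y => forall z, In z l -> fst (F z) y), (fun y => exists z, In z l /\ snd (F z) y).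
  split; [apply open_forall_list; intros z Hz; now apply HF, Al |].
  split.
  (* [F z] is known to be open only for [z] in [A]; an index outside [l] contributes the empty
     set. *)
  { apply open_ex. intros z. destruct (classic (In z l)) as [Hz | Hz].
    - eapply open_ext; [| apply (HF z (Al z Hz))]. simpl; tauto.
    - eapply open_ext; [| apply (open_const False)]. simpl; tauto. }
  split; [intros z Hz; now apply HF, Al |]. split; [exact Hl |].
  intros y [Hy [z [Hz Vz]]]. destruct (HF z (Al z Hz)) as [_ [_ [_ [_ D]]]].
  apply (D y). split; auto.
Qed.

Lemma regular_closure_inside U x :
  compact X -> hausdorff X -> open U -> U x ->
  exists V, open V /\ V x /\ forall y, (forall O, open O -> O y -> exists z, O z /\ V z) -> U y.
Proof.
  intros HX T2 HU Ux.
  destruct (compact_separate_closed (fun y => ~ U y) x HX T2) as [V [W [HV [HW [Vx [S D]]]]]].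
  - eapply open_ext; [| exact HU]. intros y; split; [tauto | apply NNPP].
  - tauto.
  - exists V. split; [exact HV |]. split; [exact Vx |]. intros y Hy. apply NNPP; intros N.
    destruct (Hy W HW (S y N)) as [z Hz]. apply (D z). tauto.
Qed.

End OpenSets.

(** A point outside the image is separated from each [f k]. Finitely many of the neighborhoods of
    the points [f k] cover the image, and the matching neighborhoods of the point intersect in a set
    missing it. *)
Lemma compact_image_closed (K X : Top) (f : K -> X) :
  compact K -> hausdorff X -> continuous K X f -> closed X (fun x => exists k, f k = x).
Proof.
  intros HK T2 Hf. apply open_nbhd. intros x Nx.
  destruct (choice (fun k (UV : (X -> Prop) * (X -> Prop)) =>
    open (fst UV) /\ open (snd UV) /\ fst UV x /\ snd UV (f k) /\
    forall y, ~ (fst UV y /\ snd UV y))) as [F HF].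
  { intros k. destruct (T2 x (f k)) as [U [V H]]; [intros ->; apply Nx; now exists k |].
    now exists (U, V). }
  destruct (HK K (fun k k' => snd (F k) (f k'))) as [l Hl].
  - intros k. apply (Hf (snd (F k))), HF.
  - intros k. exists k. apply HF.
  - exists (fun y => forall k, In k l -> fst (F k) y).
    split; [apply open_forall_list; intros k _; apply HF |].
    split; [intros k _; apply HF |]. intros y Hy [k' <-].
    destruct (Hl k') as [k [Hk Vk]]. destruct (HF k) as [_ [_ [_ [_ D]]]].
    apply (D (f k')). split; auto.
Qed.

Lemma subspace_closed_compact (X : Top) (A : X -> Prop) :
  compact X -> closed X A -> compact (subspace X A).
Proof.
  intros HX HA I U HU Hcov.
  destruct (choice (fun i V => open V /\ forall y : subspace X A, U i y <-> V (proj1_sig y)) HU)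
    as [V HV].
  destruct (compact_closed_cover X A I V HX HA) as [l Hl].
  - intros i; apply HV.
  - intros x Ax. destruct (Hcov (exist _ x Ax)) as [i Ui]. exists i. now apply HV in Ui.
  - exists l. intros [x Ax]. destruct (Hl x Ax) as [i [Hi Vi]]. exists i. split; [exact Hi |].
    now apply HV.
Qed.

Lemma subspace_hausdorff (X : Top) (A : X -> Prop) : hausdorff X -> hausdorff (subspace X A).
Proof.
  intros T2 x y N. destruct (T2 (proj1_sig x) (proj1_sig y)) as [U [V [HU [HV [Ux [Vy D]]]]]].
  { intros E. apply N. now apply sig_ext. }
  exists (fun z => U (proj1_sig z)), (fun z => V (proj1_sig z)).
  split; [now exists U |]. split; [now exists V |]. split; [exact Ux |]. split; [exact Vy |].
  intros z; apply D.
Qed.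

Lemma subspace_scattered (X : Top) (A : X -> Prop) : scattered X -> scattered (subspace X A).
Proof.
  intros S B [x Bx].
  destruct (S (fun x => exists p : A x, B (exist _ x p))) as [y [[p By] [U [HU [Uy Iso]]]]].
  - exists (proj1_sig x). destruct x as [x p]. now exists p.
  - exists (exist _ y p). split; [exact By |]. exists (fun z => U (proj1_sig z)).
    split; [now exists U |]. split; [exact Uy |]. intros [z q] Bz Uz. apply sig_ext; simpl.
    apply Iso; [now exists q | exact Uz].
Qed.

(** * Relative paracompactness *)

(** Paracompactness of a subspace in terms of open sets of the ambient space: members may leave [A],
    while refinement and local finiteness are tested only at points of [A]. *)
Definition paracompact_on (X : Top) (A : X -> Prop) : Prop :=
  forall (I : Type) (U : I -> X -> Prop), (forall i, open (U i)) ->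
    (forall x, A x -> exists i, U i x) ->
    exists (J : Type) (V : J -> X -> Prop),
      (forall j, open (V j)) /\ (forall x, A x -> exists j, V j x) /\
      (forall j, exists i, forall x, A x -> V j x -> U i x) /\
      forall x, A x -> exists W, open W /\ W x /\
        exists l : list J, forall j, (exists y, A y /\ W y /\ V j y) -> In j l.

Lemma paracompact_subspace (X : Top) (A : X -> Prop) :
  paracompact (subspace X A) <-> paracompact_on X A.
Proof.
  split.
  - intros P I U HU Hcov.
    destruct (P I (fun i y => U i (proj1_sig y))) as [J [V [HV [CV [RV LV]]]]].
    + intros i. now exists (U i).
    + intros [x Ax]. now apply Hcov.
    + destruct (choice (fun j W => open W /\ forall y : subspace X A, V j y <-> W (proj1_sig y)) HV)
        as [V' HV'].
      exists J, V'. split; [intros j; apply HV' |]. split.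
      { intros x Ax. destruct (CV (exist _ x Ax)) as [j Vj]. exists j. now apply HV' in Vj. }
      split.
      { intros j. destruct (RV j) as [i Hi]. exists i. intros x Ax Vx.
        apply (Hi (exist _ x Ax)). now apply HV'. }
      intros x Ax. destruct (LV (exist _ x Ax)) as [W [[W' [HW' EW]] [Wx [l Hl]]]].
      exists W'. split; [exact HW' |]. split; [now apply EW in Wx |]. exists l.
      intros j [y [Ay [Wy Vy]]]. apply Hl. exists (exist _ y Ay).
      split; [now apply EW | now apply HV'].
  - intros P I U HU Hcov.
    destruct (choice (fun i W => open W /\ forall y : subspace X A, U i y <-> W (proj1_sig y)) HU)
      as [U' HU'].
    destruct (P I U') as [J [V [HV [CV [RV LV]]]]].
    + intros i; apply HU'.
    + intros x Ax. destruct (Hcov (exist _ x Ax)) as [i Ui]. exists i. now apply HU' in Ui.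
    + exists J, (fun j y => V j (proj1_sig y)). split; [intros j; now exists (V j) |].
      split; [intros [x Ax]; now apply CV |]. split.
      { intros j. destruct (RV j) as [i Hi]. exists i. intros [x Ax] Vx. apply HU'. now apply Hi. }
      intros [x Ax]. destruct (LV x Ax) as [W [HW [Wx [l Hl]]]].
      exists (fun y => W (proj1_sig y)). split; [now exists W |]. split; [exact Wx |].
      exists l. intros j [[y Ay] [Wy Vy]]. apply Hl. now exists y.
Qed.

Lemma subspace_hereditarily_paracompact (X : Top) (A : X -> Prop) :
  hereditarily_paracompact X -> hereditarily_paracompact (subspace X A).
Proof.
  intros HX B. apply paracompact_subspace. intros I U HU Hcov.
  set (B' := fun x => exists p : A x, B (exist _ x p)).
  destruct (choice (fun i W => open W /\ forall y : subspace X A, U i y <-> W (proj1_sig y)) HU)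
    as [U' HU'].
  destruct (proj1 (paracompact_subspace X B') (HX B') I U') as [J [V [HV [CV [RV LV]]]]].
  - intros i; apply HU'.
  - intros x [p Bx]. destruct (Hcov _ Bx) as [i Ui]. exists i. now apply HU' in Ui.
  - exists J, (fun j y => V j (proj1_sig y)). split; [intros j; now exists (V j) |].
    split; [intros [x Ax] Bx; apply CV; now exists Ax |]. split.
    { intros j. destruct (RV j) as [i Hi]. exists i. intros [x Ax] Bx Vx. apply HU'.
      apply Hi; [now exists Ax | exact Vx]. }
    intros [x Ax] Bx. destruct (LV x) as [W [HW [Wx [l Hl]]]]; [now exists Ax |].
    exists (fun y => W (proj1_sig y)). split; [now exists W |]. split; [exact Wx |].
    exists l. intros j [[y Ay] [By [Wy Vy]]]. apply Hl. exists y.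
    split; [now exists Ay | now split].
Qed.

(** * Compact spaces containing a topological sum up to one point *)

Definition sum_in (I : Type) (K : I -> Top) (i : I) (k : K i) : top_sum I K :=
  existT (fun j => carrier (K j)) i k.

Lemma sum_in_inj (I : Type) (K : I -> Top) (i : I) (k k' : K i) :
  sum_in I K i k = sum_in I K i k' -> k = k'.
Proof. apply inj_pair2. Qed.

Lemma sum_in_open (I : Type) (K : I -> Top) (i : I) (O : K i -> Prop) :
  open O -> open (fun s : top_sum I K => exists k, O k /\ s = sum_in I K i k).
Proof.
  intros HO j. destruct (classic (j = i)) as [-> | N].
  - eapply open_ext; [| exact HO]. intros k; split; [intros Ok; now exists k |].
    intros [k' [Ok E]]. apply sum_in_inj in E. now subst.
  - eapply open_ext; [| apply (open_const _ False)]. intros k; split; [easy |].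
    intros [k' [_ E]]. apply N. exact (f_equal (@projT1 _ _) E).
Qed.

Section SumExtension.
Context (I : Type) (K : I -> Top) (X : Top) (e : top_sum I K -> X).
Hypotheses (HX : compact X) (T2 : hausdorff X) (He : embedding (top_sum I K) X e)
  (HK : forall i, compact (K i))
  (Hrem : forall p q : X, (forall s, e s <> p) -> (forall s, e s <> q) -> p = q).

(** The image is the trace on the range of an open set of [X], and the range is open because its
    complement has at most one point. *)
Lemma sum_image_open (U : top_sum I K -> Prop) :
  open U -> open (fun x => exists s, U s /\ e s = x).
Proof.
  intros HU. destruct He as [_ [_ Ho]]. destruct (Ho U HU) as [V [HV EV]].
  assert (R : open (fun x => exists s, e s = x)).
  { destruct (classic (exists p, forall s, e s <> p)) as [[p Hp] | N].
    - eapply open_ext; [| apply (hausdorff_T1 X T2 p)]. intros x; split.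
      + intros Nx. apply NNPP; intros Nex. apply Nx, Hrem; [| exact Hp].
        intros s E. apply Nex. now exists s.
      + intros [s <-]. apply Hp.
    - eapply open_ext; [| apply open_full]. intros x; split; [intros _ | easy].
      apply NNPP; intros Nex. apply N. exists x. intros s E. apply Nex. now exists s. }
  eapply open_ext; [| exact (open_inter X _ _ HV R)]. intros x; split.
  - intros [Vx [s <-]]. exists s. split; [now apply EV | reflexivity].
  - intros [s [Us <-]]. split; [now apply EV | now exists s].
Qed.

Lemma summand_clopen (i : I) : clopen X (fun x => exists k, e (sum_in I K i k) = x).
Proof.
  split.
  - eapply open_ext; [| apply (sum_image_open _ (sum_in_open I K i _ (open_full (K i))))].
    intros x; split; [intros [s [[k [_ ->]] <-]]; now exists k |].
    intros [k <-]. exists (sum_in I K i k). split; [now exists k | reflexivity].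
  - apply (compact_image_closed (K i) X (fun k => e (sum_in I K i k)) (HK i) T2).
    intros V HV. exact (proj1 He V HV i).
Qed.

(** The complement of [U] is compact and lies in the range, [p] being the only point outside the
    range. The summands are open and disjoint, so finitely many of them cover it and the others lie
    in [U]. *)
Lemma sum_remainder_nbhd (U : X -> Prop) (p : X) :
  open U -> U p -> (forall s, e s <> p) ->
  exists l : list I, forall i, In i l \/ forall k, U (e (sum_in I K i k)).
Proof.
  intros HU Up Hp.
  destruct (compact_closed_cover X (fun x => ~ U x) I
    (fun i x => exists k, e (sum_in I K i k) = x) HX) as [l Hl].
  - eapply open_ext; [| exact HU]. intros y; split; [tauto | apply NNPP].
  - intros i. apply summand_clopen.
  - intros x Nx. destruct (classic (exists s, e s = x)) as [[[i k] E] | N].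
    + exists i, k. exact E.
    + exfalso. apply Nx. rewrite (Hrem x p); auto. intros s E. apply N. now exists s.
  - exists l. intros i. destruct (classic (In i l)) as [Hi | Hi]; [now left | right].
    intros k. apply NNPP; intros N. destruct (Hl _ N) as [j [Hj [k' E]]].
    destruct He as [_ [inj _]]. apply inj in E. apply Hi.
    apply (f_equal (@projT1 _ _)) in E. simpl in E. now subst.
Qed.

(** A set meeting a summand has a point isolated within that summand, hence isolated in [X], since
    summands have open images; a set missing all summands has at most one point. *)
Lemma sum_extension_scattered : (forall i, scattered (K i)) -> scattered X.
Proof.
  intros S A [x Ax]. destruct (classic (exists i k, A (e (sum_in I K i k)))) as [[i Ai] | N].
  - destruct (S i (fun k => A (e (sum_in I K i k))) Ai) as [k [Ak [O [HO [Ok Iso]]]]].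
    exists (e (sum_in I K i k)). split; [exact Ak |].
    exists (fun x => exists s, (exists k, O k /\ s = sum_in I K i k) /\ e s = x).
    split; [now apply sum_image_open, sum_in_open |].
    split; [exists (sum_in I K i k); split; [now exists k | reflexivity] |].
    intros y Ay [s [[k' [Ok' ->]] <-]]. now rewrite (Iso k').
  - exists x. split; [exact Ax |]. exists (fun _ => True). split; [apply open_full |].
    split; [exact Logic.I |]. intros y Ay _.
    apply Hrem; intros [i k] E; apply N; exists i, k; unfold sum_in; now rewrite E.
Qed.

(* A member of the cover containing the remainder point swallows all but finitely many summands,
   so only these need to be refined. *)
Lemma sum_extension_hereditarily_paracompact :
  (forall i, hereditarily_paracompact (K i)) -> hereditarily_paracompact X.
Proof.
  intros P A. apply paracompact_subspace. intros IU U HU Hcov.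
  (* For empty [A] the cover may have no index at all, while [i0] below needs one. *)
  destruct (classic (exists a, A a)) as [[a Aa] | Nemp].
  2: { exists False, (fun _ _ => True). split; [easy |]. split; [| split; [easy |]];
       intros x Ax; destruct Nemp; now exists x. }
  (* [act] marks the summands to be refined, and [Vinf] contains all the others. If the remainder
     point lies in [A], then [Vinf] is a cover member around it and [act] is finite; otherwise
     [Vinf] is empty and every summand is active. *)
  assert (Hcase : exists (i0 : IU) (Vinf : X -> Prop) (act : I -> Prop),
    (open Vinf /\ forall x, Vinf x -> U i0 x) /\
    (forall i k, act i \/ Vinf (e (sum_in I K i k))) /\
    forall p, A p -> (forall s, e s <> p) ->
      Vinf p /\ exists l, forall i, act i -> In i l).
  { destruct (classic (exists p, A p /\ forall s, e s <> p)) as [[p [Ap Hp]] | N].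
    - destruct (Hcov p Ap) as [i0 Up].
      destruct (sum_remainder_nbhd (U i0) p (HU i0) Up Hp) as [l Hl].
      exists i0, (U i0), (fun i => In i l). split; [split; [apply HU | easy] |]. split.
      + intros i k. destruct (Hl i); [now left | right; auto].
      + intros q _ Hq. rewrite (Hrem q p Hq Hp). split; [exact Up |]. now exists l.
    - destruct (Hcov a Aa) as [i0 _]. exists i0, (fun _ => False), (fun _ => True).
      split; [split; [apply open_const | easy] |]. split; [tauto |].
      intros p Ap Hp. destruct N. now exists p. }
  destruct Hcase as [i0 [Vinf [act [[Oinf Sinf] [Hact Hp]]]]].
  set (Ai := fun i k => A (e (sum_in I K i k))).
  assert (Href : forall i, exists JV : {J : Type & J -> K i -> Prop},
    (forall j, open (projT2 JV j)) /\ (forall k, Ai i k -> exists j, projT2 JV j k) /\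
    (forall j, exists u, forall k, Ai i k -> projT2 JV j k -> U u (e (sum_in I K i k))) /\
    forall k, Ai i k -> exists W, open W /\ W k /\ exists l : list (projT1 JV),
      forall j, (exists k', Ai i k' /\ W k' /\ projT2 JV j k') -> In j l).
  { intros i. destruct (proj1 (paracompact_subspace (K i) (Ai i)) (P i (Ai i)) IU
      (fun u k => U u (e (sum_in I K i k)))) as [J [V HV]].
    - intros u. exact (proj1 He (U u) (HU u) i).
    - intros k Ak. exact (Hcov _ Ak).
    - now exists (existT _ J V). }
  apply dep_choice in Href. destruct Href as [JV HJV].
  pose (J := option {i : I & projT1 (JV i)}).
  pose (V := fun (o : J) (x : X) => match o with
    | None => Vinf x
    | Some (existT i j) => act i /\ exists s,
        (exists k, projT2 (JV i) j k /\ s = sum_in I K i k) /\ e s = x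
    end).
  exists J, V. split; [| split; [| split]].
  - intros [[i j] |]; [| exact Oinf]. apply open_inter; [apply open_const |].
    apply sum_image_open, sum_in_open, HJV.
  - intros x Ax. destruct (classic (exists s, e s = x)) as [[[i k] <-] | N].
    + destruct (Hact i k) as [Hi | Hi]; [| now exists None].
      destruct (HJV i) as [_ [C _]]. destruct (C k Ax) as [j Vj].
      exists (Some (existT _ i j)). split; [exact Hi |].
      exists (sum_in I K i k). split; [now exists k | reflexivity].
    + exists None. apply (Hp x Ax). intros s E. apply N. now exists s.
  - intros [[i j] |]; [| exists i0; auto].
    destruct (HJV i) as [_ [_ [R _]]]. destruct (R j) as [u Hu]. exists u.
    intros x Ax [_ [s [[k [Vk ->]] <-]]]. now apply Hu.
  - intros x Ax. destruct (classic (exists s, e s = x)) as [[[i k] <-] | N].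
    + destruct (HJV i) as [_ [_ [_ L]]]. destruct (L k Ax) as [W [HW [Wk [l Hl]]]].
      exists (fun x => exists s, (exists k, W k /\ s = sum_in I K i k) /\ e s = x).
      split; [now apply sum_image_open, sum_in_open |].
      split; [exists (sum_in I K i k); split; [now exists k | reflexivity] |].
      exists (None :: map (fun j => Some (existT _ i j)) l).
      intros [[i' j] |] [y [Ay [[s [[k1 [W1 ->]] <-]] Vy]]]; [| now left]. right.
      destruct Vy as [_ [s [[k2 [V2 ->]] E]]]. apply He in E.
      assert (i' = i) by exact (f_equal (@projT1 _ _) E). subst i'. apply sum_in_inj in E. subst k2.
      apply in_map_iff. exists j. split; [reflexivity |]. apply Hl. now exists k1.
    + assert (Nx : forall s, e s <> x) by (intros s E; apply N; now exists s).
      destruct (Hp x Ax Nx) as [_ [l Hl]].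
      (* Removing the finitely many active summands leaves a neighborhood that can meet only the
         member [None]. *)
      exists (fun y => forall i, In i l -> ~ exists k, e (sum_in I K i k) = y).
      split; [apply open_forall_list; intros i _; apply summand_clopen |].
      split; [intros i _ [k E]; exact (Nx _ E) |].
      exists (None :: nil). intros [[i j] |] [y [_ [Wy Vy]]]; [| now left].
      destruct Vy as [Hi [s [[k [_ ->]] <-]]]. destruct (Wy i (Hl i Hi)). now exists k.
Qed.

End SumExtension.

Lemma classA_compact_hausdorff (X : Top) : classA X -> compact X /\ hausdorff X.
Proof.
  intros HX. destruct HX as [X N | X [x Hx] | I K _ X e [[C [T2 _]] _]]; [| | now split].
  - split; [intros I U _ _; exists nil; intros x | intros x]; destruct (N x).
  - split.
    + intros I U _ Hcov. destruct (Hcov x) as [i Ui]. exists (i :: nil).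
      intros y. exists i. rewrite (Hx y). simpl; auto.
    + intros y z N. destruct N. now rewrite (Hx y), (Hx z).
Qed.

Lemma classA_scattered_hereditarily_paracompact (X : Top) :
  classA X -> scattered X /\ hereditarily_paracompact X.
Proof.
  induction 1 as [X N | X [x Hx] | I K HA IH X e [[C [T2 [He _]]] Hrem]].
  - split; [intros A [x _]; destruct (N x) |]. intros A. apply paracompact_subspace.
    intros IU U _ _. exists False, (fun _ _ => True). repeat split; try easy;
    intros x; destruct (N x).
  - split.
    + intros A [y Ay]. exists y. split; [exact Ay |]. exists (fun _ => True).
      split; [apply open_full |]. split; [easy |]. intros z _ _. now rewrite (Hx y), (Hx z).
    + intros A. apply paracompact_subspace. intros IU U HU Hcov.
      destruct (classic (A x)) as [Ax | Nx].
      * destruct (Hcov x Ax) as [i Ui]. exists unit, (fun _ _ => True).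
        split; [intros _; apply open_full |]. split; [now exists tt |].
        split; [intros _; exists i; intros y _ _; now rewrite (Hx y) |].
        intros y _. exists (fun _ => True). split; [apply open_full |]. split; [easy |].
        exists (tt :: nil). intros [] _. now left.
      * exists False, (fun _ _ => True). split; [easy |].
        split; [intros y Ay; destruct Nx; now rewrite <- (Hx y) |].
        split; [easy | intros y Ay; destruct Nx; now rewrite <- (Hx y)].
  - assert (HK : forall i, compact (K i)) by (intros i; apply classA_compact_hausdorff, HA).
    split.
    + apply (sum_extension_scattered I K X e T2 He Hrem). intros i; apply IH.
    + apply (sum_extension_hereditarily_paracompact I K X e C T2 He HK Hrem). intros i; apply IH.
Qed.

(** * Partitions into open sets *)

(* The partition of [W] is given by its labelling [f]; only labels of points of [W] matter. *)
Definition open_partition (X : Top) (W : X -> Prop) (T : Type) (f : X -> T)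
  (CU : (X -> Prop) -> Prop) : Prop :=
  (forall x, W x -> open (fun y => W y /\ f y = f x)) /\
  forall x, W x -> exists U, CU U /\ forall y, W y -> f y = f x -> U y.

Definition ultraparacompact_on (X : Top) (W : X -> Prop) : Prop :=
  forall CU : (X -> Prop) -> Prop, (forall U, CU U -> open U) ->
    (forall x, W x -> exists U, CU U /\ U x) ->
    exists f : X -> X -> Prop, open_partition X W (X -> Prop) f CU.

Section Partitions.
Context (X : Top).

(** Replacing each label by the set of points of [W] that carry it keeps the fibers, so
    constructions may use labels of any type, such as pairs or options. *)
Lemma open_partition_relabel (W : X -> Prop) (T : Type) (f : X -> T) CU :
  open_partition X W T f CU -> exists f', open_partition X W (X -> Prop) f' CU.
Proof.
  intros [Of Rf]. set (f' := fun x y => W y /\ f y = f x).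
  assert (E : forall x y, W x -> W y -> (f' y = f' x <-> f y = f x)).
  { intros x y Wx Wy. split.
    - intros E. assert (H : f' x y) by (rewrite <- E; now split). apply H.
    - intros E. apply pred_ext. intros z. unfold f'. now rewrite E. }
  exists f'. split.
  - intros x Wx. eapply open_ext; [| exact (Of x Wx)]. intros y; simpl.
    split; intros [Wy H]; (split; [exact Wy | now apply E]).
  - intros x Wx. destruct (Rf x Wx) as [U [HU S]]. exists U. split; [exact HU |].
    intros y Wy H. apply S; [exact Wy |]. now apply E.
Qed.

(** A point of [D] outside the fiber has its own fiber as a neighborhood, and a point outside [D]
    has the complement of [D]; both miss the given fiber. *)
Lemma open_partition_fiber_clopen (W D : X -> Prop) (T : Type) (f : X -> T) CU x :
  open_partition X W T f CU -> closed X D -> (forall y, D y -> W y) ->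
  W x -> (forall y, W y -> f y = f x -> D y) -> clopen X (fun y => W y /\ f y = f x).
Proof.
  intros [Of _] CD DW Wx S. split; [now apply Of |].
  apply open_nbhd. intros y Ny. destruct (classic (D y)) as [Dy | Nd].
  - exists (fun z => W z /\ f z = f y). split; [now apply Of, DW |]. split; [now split; [apply DW |] |].
    intros z [Wz E] [_ E']. apply Ny. split; [now apply DW | congruence].
  - exists (fun z => ~ D z). split; [exact CD |]. split; [exact Nd |]. intros z Nz [Wz E]. auto.
Qed.

(** A cover of [D] is cut down to [D] and completed by [W] minus [D]. Fibers subordinate to this
    larger cover cannot straddle [D], so the partition restricts. *)
Lemma ultraparacompact_on_relatively_clopen (W D : X -> Prop) :
  ultraparacompact_on X W -> open D -> (forall x, D x -> W x) ->
  open (fun x => W x /\ ~ D x) -> ultraparacompact_on X D.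
Proof.
  intros HW OD DW OWD CU OCU Hcov.
  destruct (HW (fun V => (exists U, CU U /\ V = fun x => D x /\ U x) \/ V = fun x => W x /\ ~ D x))
    as [f [Of Rf]].
  - intros V [[U [HU ->]] | ->]; [apply open_inter; auto | exact OWD].
  - intros x Wx. destruct (classic (D x)) as [Dx | N].
    + destruct (Hcov x Dx) as [U [HU Ux]]. exists (fun x => D x /\ U x).
      split; [left; now exists U | now split].
    + exists (fun x => W x /\ ~ D x). split; [now right | now split].
  - exists f. split.
    + intros x Dx. eapply open_ext; [| exact (open_inter X _ _ OD (Of x (DW x Dx)))].
      intros y; simpl. split; [tauto |]. intros [Dy E]; auto.
    + intros x Dx. destruct (Rf x (DW x Dx)) as [V [[[U [HU ->]] | ->] S]].
      * exists U. split; [exact HU |]. intros y Dy E. now apply S; [apply DW |].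
      * exfalso. destruct (S x (DW x Dx) eq_refl). contradiction.
Qed.

End Partitions.

(** * Scattered hereditarily paracompact compacta belong to the class A *)

Section ScatteredCompact.
Context (X : Top) (HX : compact X) (T2 : hausdorff X) (HS : scattered X).

(* If [x] is isolated among the points without a clopen base, the boundary of a small neighborhood
   of [x] is covered by finitely many clopen sets avoiding [x], and removing these makes the
   neighborhood clopen. *)
Lemma scattered_compact_zero_dimensional : forall (x : X) (O : X -> Prop),
  open O -> O x -> exists U, clopen X U /\ U x /\ forall y, U y -> O y.
Proof.
  set (good := fun x : X => forall O : X -> Prop, open O -> O x ->
    exists U, clopen X U /\ U x /\ forall y, U y -> O y).
  change (forall x, good x). apply NNPP; intros N. apply not_all_ex_not in N.
  destruct (HS (fun x => ~ good x) N) as [x [Bx [V [HV [Vx Iso]]]]].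
  apply Bx. intros O HO Ox.
  destruct (regular_closure_inside X (fun y => O y /\ V y) x HX T2 (open_inter X O V HO HV)
    (conj Ox Vx)) as [G [HG [Gx SG]]].
  set (clG := fun y => forall P : X -> Prop, open P -> P y -> exists z, P z /\ G z).
  (* A boundary point of [G] lies in [V] and differs from [x], so it is good and has a clopen
     neighborhood avoiding [x]. *)
  assert (Hbd : forall z, clG z /\ ~ G z -> exists U, clopen X U /\ U z /\ ~ U x).
  { intros z [Cz Nz].
    destruct (classic (good z)) as [gz | bz].
    - destruct (gz _ (hausdorff_T1 X T2 x)) as [U [CU [Uz S]]].
      + intros ->; contradiction.
      + exists U. split; [exact CU |]. split; [exact Uz |]. intros Ux. now apply (S x).
    - exfalso. apply Nz. rewrite (Iso z bz); [exact Gx |]. now apply SG. }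
  destruct (choice (fun z U => clG z /\ ~ G z -> clopen X U /\ U z /\ ~ U x)) as [D HD].
  { intros z. destruct (classic (clG z /\ ~ G z)) as [H | H].
    - destruct (Hbd z H) as [U HU]. now exists U.
    - now exists (fun _ => True). }
  destruct (compact_closed_nbhds X (fun z => clG z /\ ~ G z) D HX) as [l [Al Hl]].
  - eapply open_ext; [| exact (open_or X _ _ (closure_closed X G) HG)].
    intros y; simpl; fold (clG y). destruct (classic (G y)); tauto.
  - intros z Hz. destruct (HD z Hz) as [[OU _] [Uz _]]. now split.
  (* Since the sets [D z] cover the boundary, [G] and its closure have the same trace on [R]; that
     trace is therefore both open and closed. *)
  - set (R := fun y => forall z, In z l -> ~ D z y).
    assert (CR : clopen X R).
    { apply clopen_forall_list. intros z Hz. apply clopen_not, HD, Al, Hz. }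
    exists (fun y => G y /\ R y). split; [split |].
    + apply open_inter; [exact HG | apply CR].
    + eapply open_ext; [| exact (open_or X _ _ (closure_closed X G) (proj2 CR))].
      intros y; simpl; fold (clG y). split; [| intros H].
      * intros [Ny | Ny]; [| tauto]. intros [Gy _]. apply Ny. intros P _ Py. now exists y.
      * destruct (classic (R y)) as [Ry | Nr]; [left | now right]. intros Cy.
        destruct (Hl y) as [z [Hz Dz]]; [tauto |]. exact (Ry z Hz Dz).
    + split; [split; [exact Gx |]; intros z Hz; apply HD, Al, Hz |].
      intros y [Gy _]. apply SG. intros P _ Py. now exists y.
Qed.

(** Each point [z] gets a clopen neighborhood [N z] inside a member of a locally finite refinement
    [V], and finitely many of them, with [z] in [L m], cover the closure of [V m]. A point is
    labelled by the set of selected [z] whose [N z] contains it. Near any point only finitely many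
    selected sets matter, so labels are locally constant, and each label names a set inside a member
    of the cover. *)
Lemma paracompact_on_ultraparacompact_on (Y : X -> Prop) :
  open Y -> paracompact_on X Y -> ultraparacompact_on X Y.
Proof.
  intros OY PY CU OCU Hcov.
  (* The cover is first shrunk to clopen, hence compact, sets inside [Y], so that closures of the
     members of the refinement stay in [Y]. *)
  destruct (PY {G : X -> Prop | clopen X G /\ (forall y, G y -> Y y) /\
      exists U, CU U /\ forall y, G y -> U y} (fun G => proj1_sig G))
    as [J [V [OV [CV [RV LV]]]]].
  { intros [G HG]. exact (proj1 (proj1 HG)). }
  { intros x Yx. destruct (Hcov x Yx) as [U [HU Ux]].
    destruct (scattered_compact_zero_dimensional x (fun y => Y y /\ U y)) as [G [CG [Gx SG]]].
    - apply open_inter; auto.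
    - now split.
    - unshelve eexists (exist _ G _); [| exact Gx].
      split; [exact CG |]. split; [intros y Gy; now apply SG |].
      exists U. split; [exact HU | intros y Gy; now apply SG]. }
  set (meets := fun (A B : X -> Prop) => exists y, Y y /\ A y /\ B y).
  (* Members of the refinement have compact closures in [Y], hence meet finitely many others. *)
  assert (HSt : forall j, exists l, forall k, meets (V j) (V k) -> In k l).
  { intros j. destruct (RV j) as [[G HG] Hj]. simpl in Hj. destruct HG as [[OG CG] [GY _]].
    destruct (choice (fun z (Wl : (X -> Prop) * list J) => Y z -> open (fst Wl) /\ fst Wl z /\
      forall k, meets (fst Wl) (V k) -> In k (snd Wl))) as [F HF].
    { intros z. destruct (classic (Y z)) as [Yz | N].
      - destruct (LV z Yz) as [W [HW [Wz [l Hl]]]]. exists (W, l). intros _. now split.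
      - exists (fun _ => True, nil). tauto. }
    destruct (compact_closed_nbhds X G (fun z => fst (F z)) HX CG) as [lz [Gz Hlz]].
    - intros z Gz. destruct (HF z (GY z Gz)) as [H1 [H2 _]]. now split.
    - exists (flat_map (fun z => snd (F z)) lz). intros k [y [Yy [Vj Vk]]].
      destruct (Hlz y (Hj y Yy Vj)) as [z [Hz Wz]]. apply in_flat_map. exists z.
      split; [exact Hz |]. apply HF; [now apply GY, Gz |]. now exists y. }
  apply choice in HSt. destruct HSt as [S HSt].
  destruct (choice (fun z (N : X -> Prop) => Y z -> clopen X N /\ N z /\ (forall y, N y -> Y y) /\
    exists k, forall y, N y -> V k y)) as [N HN].
  { intros z. destruct (classic (Y z)) as [Yz | Nz]; [| now exists Y].
    destruct (CV z Yz) as [k Vk].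
    destruct (scattered_compact_zero_dimensional z (fun y => Y y /\ V k y)) as [G [CG [Gz SG]]].
    - apply open_inter; auto.
    - now split.
    - exists G. intros _. split; [exact CG |]. split; [exact Gz |].
      split; [intros y Gy; now apply SG |]. exists k. intros y Gy; now apply SG. }
  (* [V m] may leave [Y]; only its part inside [Y] is closed up. *)
  set (cl := fun m z => forall O : X -> Prop, open O -> O z -> exists y, O y /\ (Y y /\ V m y)).
  assert (HL : forall m, exists l, (forall z, In z l -> cl m z) /\
      forall x, cl m x -> exists z, In z l /\ N z x).
  { intros m. destruct (RV m) as [[G HG] Hm]. simpl in Hm. destruct HG as [[OG CG] [GY _]].
    apply (compact_closed_nbhds X (cl m) N HX); [apply closure_closed |].
    intros z Cz. assert (Gz : G z).
    { apply NNPP; intros Nz. destruct (Cz _ CG Nz) as [y [Ny [Yy Vy]]]. auto. }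
    destruct (HN z (GY z Gz)) as [[ON _] [Nz _]]. now split. }
  apply choice in HL. destruct HL as [L HL].
  assert (LY : forall m z, In z (L m) -> Y z).
  { intros m z Hz. destruct (RV m) as [[G HG] Hm]. simpl in Hm. destruct HG as [[OG CG] [GY _]].
    apply GY, NNPP. intros Nz. destruct (proj1 (HL m) z Hz _ CG Nz) as [y [Ny [Yy Vy]]]. auto. }
  apply (open_partition_relabel X Y (X -> Prop) (fun y z => (exists m, In z (L m)) /\ N z y)).
  split.
  - intros x _. apply open_nbhd. intros y [Yy Ey]. destruct (CV y Yy) as [m0 Vy].
    (* If [N z] meets [V m0] and lies in [V k], then [V k] meets [V m0]. If moreover [z] is in the
       closure of [V m], then [V k] meets [V m]. So every relevant [m] is two steps from [m0], and
       [Z] is a finite list of all relevant [z]. *)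
    pose (Z := flat_map L (flat_map S (S m0))).
    assert (HZ : forall z, (exists m, In z (L m)) -> meets (V m0) (N z) -> In z Z).
    { intros z [m Hz] [w [Yw [Vw Nw]]]. destruct (HN z (LY m z Hz)) as [_ [Nz [_ [k Hk]]]].
      apply in_flat_map. exists m. split; [| exact Hz]. apply in_flat_map. exists k.
      split; [apply HSt; exists w; split; auto |]. apply HSt.
      destruct (proj1 (HL m) z Hz (V k) (OV k) (Hk z Nz)) as [u [Vu [Yu Vmu]]]. now exists u. }
    exists (fun w => (Y w /\ V m0 w) /\
      forall z, In z Z -> ((exists m, In z (L m)) -> (N z w <-> N z y))).
    split.
    { apply open_inter; [apply open_inter; auto |]. apply open_forall_list. intros z _.
      destruct (classic (exists m, In z (L m))) as [[m Hz] | Hz].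
      - destruct (HN z (LY m z Hz)) as [[ON CN] _]. destruct (classic (N z y)) as [Ny | Ny].
        + eapply open_ext; [| exact ON]. intros w; split; [tauto |].
          intros H. apply H; [now exists m | exact Ny].
        + eapply open_ext; [| exact CN]. intros w; split; [tauto |].
          intros H Nw. apply Ny, H; [now exists m | exact Nw].
      - eapply open_ext; [| apply open_full]. tauto. }
    split; [split; [now split | tauto] |]. intros w [[Yw Vw] Hw]. split; [exact Yw |].
    rewrite <- Ey. apply pred_ext. intros z.
    split; intros [Hm Nz]; (split; [exact Hm |]); apply (Hw z); auto;
      apply HZ; auto; [now exists w | now exists y].
  - intros x Yx. destruct (CV x Yx) as [m Vx].
    destruct (proj2 (HL m) x) as [z [Hz Nz]].
    { intros O _ Ox. now exists x. }
    destruct (HN z (LY m z Hz)) as [_ [_ [_ [k Hk]]]].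
    destruct (RV k) as [[G HG] Hj]. simpl in Hj. destruct HG as [_ [_ [U [HU GU]]]].
    exists U. split; [exact HU |]. intros y Yy Ey. apply GU, Hj; [exact Yy |]. apply Hk.
    assert (H : (exists m, In z (L m)) /\ N z x) by (split; [now exists m | exact Nz]).
    rewrite <- (equal_f Ey z) in H. apply H.
Qed.

(** The sum of the cells maps into [C]. Openness and disjointness make this map an embedding, and
    the last two hypotheses are the bound on the remainder and the density required of an
    Aleksandrov compactification. *)
Lemma classA_partition (C : X -> Prop) (I : Type) (P : I -> X -> Prop) :
  closed X C -> (forall i, open (P i)) -> (forall i x, P i x -> C x) ->
  (forall i j x, P i x -> P j x -> i = j) -> (forall i, classA (subspace X (P i))) ->
  (forall p q, C p -> C q -> (forall i, ~ P i p) -> (forall i, ~ P i q) -> p = q) ->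
  (forall V p, open V -> V p -> C p -> exists i x, P i x /\ V x) ->
  classA (subspace X C).
Proof.
  intros CC OP PC Disj HA Hrem Hdense.
  set (e := fun s : top_sum I (fun i => subspace X (P i)) =>
    exist C (proj1_sig (projT2 s)) (PC (projT1 s) _ (proj2_sig (projT2 s))) : subspace X C).
  apply (classA_alex I (fun i => subspace X (P i)) HA (subspace X C) e).
  split.
  - split; [now apply subspace_closed_compact |]. split; [now apply subspace_hausdorff |].
    split; [split; [| split] |].
    + intros V [V' [OV EV]] i. exists V'. split; [exact OV |]. intros y. apply EV.
    + intros [i [x p]] [j [y q]] E. apply (f_equal (@proj1_sig _ _)) in E. simpl in E. subst y.
      assert (i = j) by exact (Disj i j x p q). subst j. now rewrite (proof_irrelevance _ p q).
    + intros U OU. apply dep_choice in OU. destruct OU as [V HV].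
      exists (fun y : subspace X C => exists i, P i (proj1_sig y) /\ V i (proj1_sig y)). split.
      * exists (fun x => exists i, P i x /\ V i x). split; [| tauto].
        apply open_ex. intros i. apply open_inter; [apply OP | apply HV].
      * intros [i [x p]]. simpl. split.
        -- intros Ux. exists i. split; [exact p |]. now apply (HV i) in Ux.
        -- intros [j [q Vx]]. assert (j = i) by exact (Disj j i x q p). subst j.
           now apply (HV i).
    + intros V [V' [OV EV]] [[p Cp] Vp]. apply EV in Vp.
      destruct (Hdense V' p OV Vp Cp) as [i [x [Px Vx]]].
      exists (existT _ i (exist _ x Px)). now apply EV.
  - intros [p Cp] [q Cq] Np Nq. apply sig_ext; simpl. apply Hrem; auto; intros i Pi.
    + apply (Np (existT _ i (exist _ p Pi))). now apply sig_ext.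
    + apply (Nq (existT _ i (exist _ q Pi))). now apply sig_ext.
Qed.

Lemma scattered_hereditarily_paracompact_classA : hereditarily_paracompact X -> classA X.
Proof.
  intros HP.
  (* Quantifying over clopen subsets makes [ok] hereditary: the cells of a partition are only clopen
     subsets of the covering sets. *)
  set (ok := fun U : X -> Prop => clopen X U /\
    forall C, clopen X C -> (forall y, C y -> U y) -> classA (subspace X C)).
  (* Used with [Y] equal to [C] minus a bad point, and with [Y] and [C] both the whole space. *)
  assert (Hpart : forall Y C, clopen X C -> open Y -> (forall y, Y y -> C y) ->
    (forall y, Y y -> exists U, ok U /\ U y) ->
    (forall p q, C p -> C q -> ~ Y p -> ~ Y q -> p = q) -> classA (subspace X C)).
  { intros Y C [OC CC] OY YC Yok Hrem.
    (* Cover members are taken inside [Y]: each cell then lies in a clopen set contained in [Y],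
       which makes it clopen in [X]. *)
    destruct (paracompact_on_ultraparacompact_on Y OY (proj1 (paracompact_subspace X Y) (HP Y))
      (fun U => ok U /\ forall y, U y -> Y y)) as [f Hf].
    { intros U [[[OU _] _] _]. exact OU. }
    { intros y Yy. destruct (Yok y Yy) as [U [[CU HU] Uy]].
      destruct (scattered_compact_zero_dimensional y (fun z => U z /\ Y z)) as [G [CG [Gy SG]]].
      - apply open_inter; [apply CU | exact OY].
      - now split.
      - exists G. split; [split |]; [| intros z Gz; now apply SG | exact Gy].
        split; [exact CG |]. intros D CD SD. apply HU; [exact CD |]. intros z Dz. now apply SG, SD. }
    (* A left-over point that is isolated must be a cell of its own, [None], or density would fail;
       one that is not isolated becomes the point at infinity. *)
    apply (classA_partition C (option (X -> Prop)) (fun o x => match o with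
      | Some t => Y x /\ f x = t
      | None => C x /\ ~ Y x /\ open (fun z => z = x) end)); [exact CC | | | | | |].
    - intros [t |].
      + destruct (classic (exists x, Y x /\ f x = t)) as [[x [Yx <-]] | N]; [now apply Hf |].
        eapply open_ext; [| apply (open_const X False)]. intros x; split; [easy |].
        intros H. apply N. now exists x.
      + apply open_nbhd. intros x [Cx [Ny Ox]]. exists (fun z => z = x).
        split; [exact Ox |]. split; [easy |]. now intros z ->.
    - intros [t |] x; [intros [Yx _]; now apply YC | tauto].
    - intros [t |] [t' |] x; try tauto. now intros [_ <-] [_ <-].
    - intros [t |].
      + destruct (classic (exists x, Y x /\ f x = t)) as [[x [Yx <-]] | N].
        * destruct (proj2 Hf x Yx) as [U [[[CU HU] UY] SU]]. apply HU.
          -- apply (open_partition_fiber_clopen X Y U _ f _ x Hf (proj2 CU) UY Yx SU).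
          -- intros y [Yy E]. now apply SU.
        * apply classA_empty. intros [x Hx]. apply N. now exists x.
      + destruct (classic (exists x, C x /\ ~ Y x /\ open (fun z => z = x))) as [[x Hx] | N].
        * apply classA_point. exists (exist _ x Hx). intros [y [Cy [Ny Oy]]].
          apply sig_ext; simpl. apply Hrem; tauto.
        * apply classA_empty. intros [x Hx]. apply N. now exists x.
    - intros p q Cp Cq Np Nq. apply Hrem; auto; intros Yx.
      + apply (Np (Some (f p))). now split.
      + apply (Nq (Some (f q))). now split.
    - intros V p OV Vp Cp. destruct (classic (Y p)) as [Yp | Np].
      { exists (Some (f p)), p. auto. }
      destruct (classic (exists y, Y y /\ V y)) as [[y [Yy Vy]] | N].
      { exists (Some (f y)), y. auto. }
      exists None, p. split; [| exact Vp]. split; [exact Cp |]. split; [exact Np |].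
      eapply open_ext; [| exact (open_inter X _ _ OV OC)]. intros z; simpl. split.
      + intros [Vz Cz]. apply Hrem; auto. intros Yz. apply N. now exists z.
      + now intros ->. }
  assert (Hok : forall x : X, exists U, ok U /\ U x).
  { apply NNPP; intros N. apply not_all_ex_not in N.
    destruct (HS _ N) as [x [Bx [V [HV [Vx Iso]]]]]. apply Bx.
    destruct (scattered_compact_zero_dimensional x V HV Vx) as [U [CU [Ux SU]]].
    exists U. split; [| exact Ux]. split; [exact CU |]. intros C CC SC.
    apply (Hpart (fun y => C y /\ y <> x) C CC).
    - apply open_inter; [apply CC | now apply hausdorff_T1].
    - tauto.
    - intros y [Cy Ny]. apply NNPP; intros By. apply Ny, Iso; auto.
    - intros p q Cp Cq Np Nq. transitivity x; [| symmetry]; apply NNPP; tauto. }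
  assert (HA : classA (subspace X (fun _ => True))).
  { apply (Hpart (fun _ => True)); auto; [apply clopen_full | apply open_full | tauto]. }
  (* [X] is the Aleksandrov compactification, with empty remainder, of the one-term sum formed by
     its full subspace. *)
  set (e := fun s : top_sum unit (fun _ => subspace X (fun _ => True)) => proj1_sig (projT2 s)).
  apply (classA_alex unit (fun _ => subspace X (fun _ => True)) (fun _ => HA) X e).
  assert (surj : forall x, exists s, e s = x).
  { intros x. now exists (existT _ tt (exist _ x Logic.I)). }
  split.
  - split; [exact HX |]. split; [exact T2 |]. split; [split; [| split] |].
    + intros V OV i. exists V. split; [exact OV | easy].
    + intros [[] [x []]] [[] [y []]] E. unfold e in E; simpl in E. now subst.
    + intros U OU. destruct (OU tt) as [V [OV EV]]. exists V. split; [exact OV |].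
      intros [[] s]. apply EV.
    + intros V _ [p Vp]. destruct (surj p) as [s <-]. now exists s.
  - intros p q Np. destruct (surj p) as [s E]. destruct (Np s E).
Qed.

End ScatteredCompact.

(** * Scattered metric spaces are ultraparacompact *)

Section ScatteredMetric.
Context (X : Top) (d : X -> X -> R).
Hypotheses (d_pos : forall x y, 0 <= d x y) (d_zero : forall x y, d x y = 0 <-> x = y)
  (d_sym : forall x y, d x y = d y x) (d_tri : forall x y z, d x z <= d x y + d y z)
  (d_open : forall U : X -> Prop, open U <->
    forall x, U x -> exists r, 0 < r /\ forall y, d x y < r -> U y).

Lemma metric_self (x : X) : d x x = 0.
Proof. now apply d_zero. Qed.

Lemma metric_positive (x y : X) : x <> y -> 0 < d x y.
Proof. intros N. destruct (d_pos x y) as [H | H]; [exact H | destruct N; now apply d_zero]. Qed.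

Lemma ball_open (x : X) (r : R) : open (fun y => d x y < r).
Proof.
  apply d_open. intros y Hy. exists (r - d x y). split; [lra |].
  intros z Hz. pose proof (d_tri x y z). lra.
Qed.

Lemma metric_T1 (x : X) : open (fun y => y <> x).
Proof.
  apply d_open. intros y N. exists (d y x). split; [now apply metric_positive |].
  intros z Hz ->. lra.
Qed.

Lemma inv_succ_positive (n : nat) : 0 < / INR (S n).
Proof. apply Rinv_0_lt_compat, lt_0_INR. lia. Qed.

Lemma inv_succ_small (r : R) : 0 < r -> exists n, / INR (S n) < r.
Proof.
  intros Hr. destruct (archimed_cor1 r Hr) as [n [Hn Pn]]. exists (pred n).
  now replace (S (pred n)) with n by lia.
Qed.

(* Following Stone: order the cover, let [E n G] be the points for which [G] is the first member
   containing them and which are 1/n-deep in [G]. For fixed [n] the sets [E n G] are 1/n-separated;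
   ultraparacompactness of [G] enlarges them to clopen sets that stay 1/(3n)-separated. *)
Lemma ultraparacompact_on_local (W : X -> Prop) (CG : (X -> Prop) -> Prop) :
  open W ->
  (forall G, CG G -> open G /\ (forall x, G x -> W x) /\ open (fun x => W x /\ ~ G x) /\
    ultraparacompact_on X G) ->
  (forall x, W x -> exists G, CG G /\ G x) ->
  ultraparacompact_on X W.
Proof.
  intros OW HCG Hcov.
  destruct (choice_order (X -> Prop)) as [lt [Hleast Htri]].
  set (eps := fun n => / INR (S n)).
  assert (Heps : forall n, 0 < eps n) by apply inv_succ_positive.
  (* Cells of [F (G, n)] lie in balls of radius [eps n / 6], so two points of a cell are less than
     [eps n / 3] apart. *)
  destruct (choice (fun (Gn : (X -> Prop) * nat) (f : X -> X -> Prop) => CG (fst Gn) ->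
    open_partition X (fst Gn) _ f
      (fun U => exists z, U = fun y => d z y < eps (snd Gn) / 6))) as [F HF].
  { intros [G n]. destruct (classic (CG G)) as [HG | N]; [| now exists (fun _ _ => True)].
    destruct (HCG G HG) as [_ [_ [_ UG]]].
    destruct (UG (fun U => exists z, U = fun y => d z y < eps n / 6)) as [f Hf].
    - intros U [z ->]. apply ball_open.
    - intros x _. exists (fun y => d x y < eps n / 6). split; [now exists x |].
      rewrite metric_self. specialize (Heps n). lra.
    - now exists f. }
  set (first := fun G z => (CG G /\ G z) /\ forall G', CG G' /\ G' z -> ~ lt G' G).
  set (E := fun n (G : X -> Prop) z => first G z /\ forall y, W y -> d z y < eps n -> G y).
  (* The union of the cells of [F (G, n)] that meet [E n G], which is clopen relative to [W] because
     [G] is. *)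
  set (C := fun n (G : X -> Prop) y => CG G /\ G y /\
    exists z, E n G z /\ F (G, n) y = F (G, n) z).
  assert (C_open : forall n G, open (C n G)).
  { intros n G. apply open_nbhd. intros y [HG [Gy [z [Ez Fz]]]].
    exists (fun w => G w /\ F (G, n) w = F (G, n) y).
    split; [now apply (proj1 (HF (G, n) HG)) |]. split; [now split |].
    intros w [Gw Fw]. split; [exact HG |]. split; [exact Gw |]. exists z. split; [exact Ez |].
    congruence. }
  assert (C_closed : forall n G, open (fun y => W y /\ ~ C n G y)).
  { intros n G. apply open_nbhd. intros y [Wy Ny].
    destruct (classic (CG G)) as [HG | NG].
    2: { exists W. split; [exact OW |]. split; [exact Wy |]. intros w Ww.
         split; [exact Ww |]. intros [H _]. contradiction. }
    destruct (HCG G HG) as [OG [GW [OWG _]]]. destruct (classic (G y)) as [Gy | NGy].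
    - exists (fun w => G w /\ F (G, n) w = F (G, n) y).
      split; [now apply (proj1 (HF (G, n) HG)) |]. split; [now split |].
      intros w [Gw Fw]. split; [now apply GW |]. intros [_ [_ [z [Ez Fz]]]]. apply Ny.
      split; [exact HG |]. split; [exact Gy |]. exists z. split; [exact Ez | congruence].
    - exists (fun w => W w /\ ~ G w). split; [exact OWG |]. split; [now split |].
      intros w [Ww Nw]. split; [exact Ww |]. intros [_ [Gw _]]. contradiction. }
  assert (C_near : forall n G y, C n G y -> exists z, E n G z /\ d z y < eps n / 3).
  { intros n G y [HG [Gy [z [Ez Fz]]]]. exists z. split; [exact Ez |].
    destruct (proj2 (HF (G, n) HG) y Gy) as [U [[w ->] S]]. simpl in S.
    assert (Gz : G z) by exact (proj2 (proj1 (proj1 Ez))).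
    pose proof (S y Gy eq_refl) as H1. pose proof (S z Gz (eq_sym Fz)) as H2. cbv beta in H1, H2.
    pose proof (d_tri z w y). rewrite (d_sym z w) in *. lra. }
  (* Three gaps of [eps n / 3] put a point [z'] of [E n G'] within [eps n] of a point of [E n G],
     hence in [G]; so [G] cannot precede [G'], the first member containing [z']. *)
  assert (C_sep : forall n G G' y y', C n G y -> C n G' y' -> d y y' < eps n / 3 -> G = G').
  { intros n.
    assert (H : forall G G' y y', C n G y -> C n G' y' -> d y y' < eps n / 3 -> ~ lt G G').
    { intros G G' y y' Cy Cy' Hd L.
      destruct (C_near n G y Cy) as [z [[[[HG Gz] _] Dz] Hz]].
      destruct (C_near n G' y' Cy') as [z' [[[[HG' Gz'] Lz'] _] Hz']].
      apply (Lz' G); [| exact L]. split; [exact HG |]. apply Dz; [now apply (HCG G' HG') |].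
      pose proof (d_tri z y z'). pose proof (d_tri y y' z'). rewrite (d_sym y' z') in *. lra. }
    intros G G' y y' Cy Cy' Hd. apply NNPP; intros N. destruct (Htri G G' N) as [L | L].
    - exact (H G G' y y' Cy Cy' Hd L).
    - rewrite d_sym in Hd. exact (H G' G y' y Cy' Cy Hd L). }
  (* A ball of radius [eps n / 6] meets at most one of the separated sets [C n G], so their union is
     relatively closed. *)
  assert (CC_closed : forall n, open (fun y => W y /\ ~ exists G, C n G y)).
  { intros n. apply open_nbhd. intros y [Wy Ny]. specialize (Heps n).
    destruct (classic (exists w G, C n G w /\ d y w < eps n / 6)) as [[w [G [Cw Hw]]] | N].
    - exists (fun u => (W u /\ ~ C n G u) /\ d y u < eps n / 6).
      split; [apply open_inter; [apply C_closed | apply ball_open] |].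
      split; [split; [split; [exact Wy |]; intros Cy; apply Ny; now exists G |];
        rewrite metric_self; lra |].
      intros u [[Wu Nu] Hu]. split; [exact Wu |]. intros [G' Cu].
      apply Nu. rewrite (C_sep n G G' w u Cw Cu); [exact Cu |].
      pose proof (d_tri w y u). rewrite (d_sym w y) in *. lra.
    - exists (fun u => W u /\ d y u < eps n / 6).
      split; [apply open_inter; [exact OW | apply ball_open] |].
      split; [split; [exact Wy |]; rewrite metric_self; lra |].
      intros u [Wu Hu]. split; [exact Wu |]. intros [G Cu]. apply N. now exists u, G. }
  (* The label is the least level [n] at which some [C n G] contains the point, together with that
     [G], which separation makes unique. *)
  set (lab := fun (x : X) (h : nat * (X -> Prop)) =>
    C (fst h) (snd h) x /\ forall m, (m < fst h)%nat -> ~ exists G, C m G x).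
  assert (lab_ex : forall x, W x -> exists h, lab x h).
  { intros x Wx. destruct (least_nat (fun n => exists G, C n G x)) as [n [[G Cx] L]].
    - destruct (Hleast (fun G => CG G /\ G x) (Hcov x Wx)) as [G HG].
      destruct (HCG G (proj1 (proj1 HG))) as [OG _].
      destruct (proj1 (d_open G) OG x (proj2 (proj1 HG))) as [r [Hr Br]].
      destruct (inv_succ_small r Hr) as [n Hn]. exists n, G.
      split; [apply HG |]. split; [apply HG |]. exists x. split; [| reflexivity].
      split; [exact HG |]. intros y _ Hy. apply Br. unfold eps in Hy. lra.
    - exists (n, G). now split. }
  assert (lab_uniq : forall x h h', lab x h -> lab x h' -> h = h').
  { intros x [n G] [n' G'] [Cx L] [Cx' L']; simpl in *.
    assert (n = n').
    { destruct (Nat.lt_trichotomy n n') as [H | [H | H]]; [| exact H |].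
      - destruct (L' n H). now exists G.
      - destruct (L n' H). now exists G'. }
    subst n'. f_equal. apply (C_sep n G G' x x Cx Cx'). rewrite metric_self.
    specialize (Heps n). lra. }
  destruct (choice (fun x h => W x -> lab x h)) as [h Hh].
  { intros x. destruct (classic (W x)) as [Wx | N].
    - destruct (lab_ex x Wx) as [h Hh]. now exists h.
    - now exists (0%nat, fun _ => True). }
  assert (h_open : forall x, W x -> open (fun y => W y /\ h y = h x)).
  { intros x Wx. pose (n := fst (h x)). pose (G := snd (h x)).
    eapply open_ext; [| exact (open_inter X _ _ (C_open n G)
      (open_forall_list X nat (seq 0 n) (fun m y => W y /\ ~ exists G, C m G y)
        (fun m _ => CC_closed m)))].
    intros y; simpl. split.
    - intros [Cy L]. assert (Wy : W y).
      { destruct Cy as [HG [Gy _]]. now apply (HCG G HG). }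
      split; [exact Wy |]. apply (lab_uniq y); [now apply Hh |]. split; [exact Cy |].
      intros m Hm. apply L. apply in_seq. unfold n. lia.
    - intros [Wy Ey]. destruct (Hh y Wy) as [Cy L]. rewrite Ey in Cy, L.
      split; [exact Cy |]. intros m Hm. split; [exact Wy |]. apply L. apply in_seq in Hm.
      unfold n in Hm. lia. }
  intros CU OCU CovU.
  (* The cell with label [(n, G)] lies in [G], so it can be cut further by a partition of [G]
     subordinate to the given cover. *)
  destruct (choice (fun G (k : X -> X -> Prop) => CG G -> open_partition X G _ k CU)) as [k Hk].
  { intros G. destruct (classic (CG G)) as [HG | N]; [| now exists (fun _ _ => True)].
    destruct (HCG G HG) as [_ [GW [_ UG]]].
    destruct (UG CU OCU) as [k Hk]; [intros x Gx; now apply CovU, GW | now exists k]. }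
  apply (open_partition_relabel X W _ (fun x => (h x, k (snd (h x)) x))).
  assert (HGx : forall x, W x -> CG (snd (h x)) /\ snd (h x) x).
  { intros x Wx. destruct (Hh x Wx) as [[HG [Gx _]] _]. now split. }
  split.
  - intros x Wx. destruct (HGx x Wx) as [HG Gx].
    eapply open_ext; [| exact (open_inter X _ _ (h_open x Wx) (proj1 (Hk _ HG) x Gx))].
    intros y; simpl. split.
    + intros [[Wy Ey] [Gy Ky]]. split; [exact Wy |]. rewrite Ey. now rewrite Ky.
    + intros [Wy E']. injection E' as Ey Ky. split; [now split |]. rewrite Ey in Ky.
      split; [| exact Ky]. rewrite <- Ey. now apply HGx.
  - intros x Wx. destruct (HGx x Wx) as [HG Gx].
    destruct (proj2 (Hk _ HG) x Gx) as [U [HU S]]. exists U. split; [exact HU |].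
    intros y Wy E'. injection E' as Ey Ky. rewrite Ey in Ky. apply S; [| exact Ky].
    rewrite <- Ey. now apply HGx.
Qed.

Context (HS : scattered X).

(* If all points of [V] other than [x] have bases of clopen ultraparacompact sets, then so has
   [x]: add to [x] all pieces meeting a small ball of a fine partition of [V] minus [x]. *)
Lemma scattered_metric_clopen_base : forall (x : X) (O : X -> Prop), open O -> O x ->
  exists U, clopen X U /\ U x /\ (forall y, U y -> O y) /\ ultraparacompact_on X U.
Proof.
  set (good := fun x : X => forall O : X -> Prop, open O -> O x ->
    exists U, clopen X U /\ U x /\ (forall y, U y -> O y) /\ ultraparacompact_on X U).
  change (forall x, good x). apply NNPP; intros N. apply not_all_ex_not in N.
  destruct (HS (fun x => ~ good x) N) as [x [Bx [V [HV [Vx Iso]]]]]. apply Bx.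
  set (W := fun y => V y /\ y <> x).
  assert (OW : open W) by (apply open_inter; [exact HV | apply metric_T1]).
  assert (UW : ultraparacompact_on X W).
  { apply (ultraparacompact_on_local W (fun G => clopen X G /\ (forall y, G y -> W y) /\
      ultraparacompact_on X G) OW).
    - intros G [[OG CG] [GW UG]]. split; [exact OG |]. split; [exact GW |].
      split; [now apply open_inter | exact UG].
    - intros y [Vy Ny]. assert (gy : good y) by (apply NNPP; intros By; now apply Ny, Iso).
      destruct (gy W OW) as [G [CG [Gy [GW UG]]]]; [now split |]. now exists G. }
  assert (Hsmall : forall O : X -> Prop, open O -> O x ->
    exists U, clopen X U /\ U x /\ forall y, U y -> O y /\ V y).
  { intros O HO Ox.
    destruct (proj1 (d_open _) (open_inter X O V HO HV) x (conj Ox Vx)) as [r [Hr Br]].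
    (* Two points of a piece are less than [r / 4] apart, so the pieces meeting the [r / 4]-ball
       around [x] stay within [r / 2] of [x]. The remaining [r / 2] is the room used to show
       closedness. *)
    destruct (UW (fun U => exists z, U = fun y => d z y < r / 8)) as [f [Of Rf]].
    { intros U [z ->]. apply ball_open. }
    { intros y _. exists (fun w => d y w < r / 8). split; [now exists y |].
      rewrite metric_self. lra. }
    set (U := fun y => y = x \/ W y /\ exists z, W z /\ f y = f z /\ d x z < r / 4).
    assert (Unear : forall y, U y -> d x y < r / 2).
    { intros y [-> | [Wy [z [Wz [Fz Hz]]]]]; [rewrite metric_self; lra |].
      destruct (Rf y Wy) as [B [[w ->] S]].
      pose proof (S y Wy eq_refl) as H1. pose proof (S z Wz (eq_sym Fz)) as H2.
      cbv beta in H1, H2. pose proof (d_tri x z y). pose proof (d_tri z w y).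
      rewrite (d_sym z w) in *. lra. }
    exists U. split; [split |].
    - apply open_nbhd. intros y [-> | [Wy [z [Wz [Fz Hz]]]]].
      + exists (fun y => d x y < r / 4). split; [apply ball_open |].
        split; [rewrite metric_self; lra |]. intros y Hy.
        destruct (classic (y = x)) as [-> | Ny]; [now left | right].
        assert (Wy : W y) by (split; [apply Br; lra | exact Ny]).
        split; [exact Wy |]. now exists y.
      + exists (fun w => W w /\ f w = f y). split; [now apply Of |]. split; [now split |].
        intros w [Ww Fw]. right. split; [exact Ww |]. exists z.
        split; [exact Wz |]. split; [congruence | exact Hz].
    - apply open_nbhd. intros y Ny. destruct (classic (W y)) as [Wy | Nw].
      + exists (fun w => W w /\ f w = f y). split; [now apply Of |]. split; [now split |].
        intros w [Ww Fw] [-> | [_ [z [Wz [Fz Hz]]]]]; [now destruct Ww |].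
        apply Ny. right. split; [exact Wy |]. exists z.
        split; [exact Wz |]. split; [congruence | exact Hz].
      + assert (Hy : r <= d x y).
        { apply Rnot_lt_le. intros Hy. destruct (classic (y = x)) as [E | Nyx]; [apply Ny; now left |].
          apply Nw. split; [now apply Br | exact Nyx]. }
        exists (fun w => d y w < r / 2). split; [apply ball_open |].
        split; [rewrite metric_self; lra |]. intros w Hw Uw. apply Unear in Uw.
        pose proof (d_tri x w y). rewrite (d_sym w y) in *. lra.
    - split; [now left |]. intros y Uy. apply Unear in Uy. apply Br. lra. }
  intros O HO Ox. destruct (Hsmall O HO Ox) as [U [[OU CU] [Ux SU]]].
  exists U. split; [now split |]. split; [exact Ux |]. split; [intros y Uy; now apply SU |].
  (* One member [O'] of the cover contains a clopen neighborhood [U'] of [x], which becomes the cell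
     [None]; the rest of [U] avoids [x] and is relatively clopen in [W]. *)
  intros CV OCV Hcov. destruct (Hcov x Ux) as [O' [HO' Ox']].
  destruct (Hsmall (fun y => O' y /\ U y)) as [U' [[OU' CU'] [Ux' SU']]];
    [apply open_inter; auto | now split |].
  assert (UR : ultraparacompact_on X (fun y => U y /\ ~ U' y)).
  { apply (ultraparacompact_on_relatively_clopen X W _ UW).
    - now apply open_inter.
    - intros y [Uy Ny]. split; [now apply SU |]. now intros ->.
    - eapply open_ext; [| exact (open_inter X _ _ OW (open_or X _ _ CU OU'))].
      intros y; simpl. split; [tauto |]. intros [Wy H]. split; [exact Wy |].
      destruct (classic (U' y)); tauto. }
  destruct (UR CV OCV) as [f [Of Rf]]; [intros y [Uy _]; now apply Hcov |].
  destruct (choice (fun y (o : option (X -> Prop)) =>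
    (U' y -> o = None) /\ (~ U' y -> o = Some (f y)))) as [g Hg].
  { intros y. destruct (classic (U' y)) as [H | H]; [now exists None | now exists (Some (f y))]. }
  apply (open_partition_relabel X U _ g). split.
  - intros y Uy. destruct (classic (U' y)) as [Hy | Hy].
    + rewrite (proj1 (Hg y) Hy). eapply open_ext; [| exact OU'].
      intros w; split; [intros Hw; split; [now apply SU' | now apply Hg] |].
      intros [Uw E]. apply NNPP; intros Nw. rewrite (proj2 (Hg w) Nw) in E. discriminate.
    + rewrite (proj2 (Hg y) Hy). eapply open_ext; [| exact (Of y (conj Uy Hy))].
      intros w; simpl. split.
      * intros [[Uw Nw] E]. split; [exact Uw |]. rewrite (proj2 (Hg w) Nw). now rewrite E.
      * intros [Uw E]. destruct (classic (U' w)) as [Hw | Hw].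
        -- rewrite (proj1 (Hg w) Hw) in E. discriminate.
        -- rewrite (proj2 (Hg w) Hw) in E. injection E as E. now split.
  - intros y Uy. destruct (classic (U' y)) as [Hy | Hy].
    + exists O'. split; [exact HO' |]. intros w Uw E. rewrite (proj1 (Hg y) Hy) in E.
      apply SU'. apply NNPP; intros Nw. rewrite (proj2 (Hg w) Nw) in E. discriminate.
    + destruct (Rf y (conj Uy Hy)) as [B [HB S]]. exists B. split; [exact HB |].
      intros w Uw E. rewrite (proj2 (Hg y) Hy) in E.
      destruct (classic (U' w)) as [Hw | Hw].
      * rewrite (proj1 (Hg w) Hw) in E. discriminate.
      * rewrite (proj2 (Hg w) Hw) in E. injection E as E. now apply S.
Qed.

Lemma scattered_metric_ultraparacompact_on (W : X -> Prop) : open W -> ultraparacompact_on X W.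
Proof.
  intros OW.
  apply (ultraparacompact_on_local W (fun G => clopen X G /\ (forall y, G y -> W y) /\
    ultraparacompact_on X G) OW).
  - intros G [[OG CG] [GW UG]]. split; [exact OG |]. split; [exact GW |].
    split; [now apply open_inter | exact UG].
  - intros y Wy. destruct (scattered_metric_clopen_base y W OW Wy) as [G [CG [Gy [GW UG]]]].
    now exists G.
Qed.

End ScatteredMetric.

(** * Scattered compactifications of scattered metrizable spaces *)

(* For compact summands a neighborhood of the new point [None] contains all but finitely many of
   them. If finitely many summands are nonempty, [None] is isolated. *)
Section OnePoint.
Context (I : Type) (K : I -> Top).

Definition one_point_open (V : option (top_sum I K) -> Prop) : Prop :=
  open (fun s : top_sum I K => V (Some s)) /\
  (V None -> exists l : list I, forall i k, In i l \/ V (Some (sum_in I K i k))).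

Lemma one_point_open_full : one_point_open (fun _ => True).
Proof. split; [apply open_full |]. intros _. exists nil. now right. Qed.

Lemma one_point_open_inter U V :
  one_point_open U -> one_point_open V -> one_point_open (fun x => U x /\ V x).
Proof.
  intros [OU LU] [OV LV]. split; [now apply (open_inter (top_sum I K)) |].
  intros [HU HV]. destruct (LU HU) as [l Hl], (LV HV) as [l' Hl']. exists (l ++ l').
  intros i k. rewrite in_app_iff. specialize (Hl i k). specialize (Hl' i k). tauto.
Qed.

Lemma one_point_open_union (F : (option (top_sum I K) -> Prop) -> Prop) :
  (forall U, F U -> one_point_open U) -> one_point_open (fun x => exists U, F U /\ U x).
Proof.
  intros HF. split.
  - apply open_nbhd. intros s [U [FU Us]]. exists (fun s => U (Some s)).
    split; [apply (HF U FU) |]. split; [exact Us |]. intros t Ut. now exists U.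
  - intros [U [FU Us]]. destruct (proj2 (HF U FU) Us) as [l Hl]. exists l. intros i k.
    destruct (Hl i k); [now left | right; now exists U].
Qed.

Definition one_point : Top :=
  {| carrier := option (top_sum I K); open := one_point_open;
     open_full := one_point_open_full; open_inter := one_point_open_inter;
     open_union := one_point_open_union |}.

Lemma one_point_embedding : embedding (top_sum I K) one_point Some.
Proof.
  split; [| split].
  - intros V [OV _]. exact OV.
  - intros s t E. now injection E.
  - intros U OU. exists (fun x => match x with Some s => U s | None => False end).
    split; [| easy]. split; [exact OU | easy].
Qed.

Lemma one_point_compact : (forall i, compact (K i)) -> compact one_point.
Proof.
  intros HK IU U HU Hcov. destruct (Hcov None) as [u0 Hu0].
  destruct (proj2 (HU u0) Hu0) as [l Hl].
  assert (HL : forall i, exists lu, forall k, exists u, In u lu /\ U u (Some (sum_in I K i k))).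
  { intros i. apply (HK i IU (fun u k => U u (Some (sum_in I K i k)))).
    - intros u. exact (proj1 (HU u) i).
    - intros k. apply Hcov. }
  apply choice in HL. destruct HL as [L HL].
  exists (u0 :: flat_map L l). intros [[i k] |]; [| exists u0; simpl; auto].
  destruct (Hl i k) as [Hi | Hk]; [| exists u0; simpl; auto].
  destruct (HL i k) as [u [Hu Uu]]. exists u. split; [| exact Uu].
  right. apply in_flat_map. now exists i.
Qed.

Lemma one_point_hausdorff : (forall i, hausdorff (K i)) -> hausdorff one_point.
Proof.
  intros HK.
  set (img := fun i (O : K i -> Prop) (x : one_point) => exists k, O k /\ x = Some (sum_in I K i k)).
  assert (Oimg : forall i O, open O -> open (img i O)).
  { intros i O HO. split.
    - eapply open_ext; [| apply (sum_in_open I K i O HO)].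
      intros s; split; intros [k [Ok E]]; exists k; (split; [exact Ok |]);
        [now rewrite E | now injection E].
    - intros [k [_ E]]. discriminate. }
  (* A summand and its complement are both open, which separates any two points not in the same
     summand. *)
  set (out := fun i (x : one_point) => ~ img i (fun _ => True) x).
  assert (Oout : forall i, open (out i)).
  { intros i. split.
    - intros j. destruct (classic (j = i)) as [-> | N].
      + eapply open_ext; [| apply (open_const _ False)]. intros k; split; [easy |].
        intros H. apply H. now exists k.
      + eapply open_ext; [| apply (open_const _ True)]. intros k; split; [| easy].
        intros _ [k' [_ E]]. apply N. injection E as E. exact E.
    - intros _. exists (i :: nil). intros j k. destruct (classic (i = j)) as [-> | N];
        [left; now left | right]. intros [k' [_ E]]. apply N. injection E as E. now symmetry. }
  assert (Hout : forall i (x y : one_point), img i (fun _ => True) x -> out i y ->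
    exists U V, open U /\ open V /\ U x /\ V y /\ forall z, ~ (U z /\ V z)).
  { intros i x y Hx Hy. exists (img i (fun _ => True)), (out i).
    split; [apply Oimg, open_full |]. split; [apply Oout |]. split; [exact Hx |].
    split; [exact Hy |]. intros z [H1 H2]. contradiction. }
  assert (Hsym : forall x y : one_point,
    (exists U V, open U /\ open V /\ U x /\ V y /\ forall z, ~ (U z /\ V z)) ->
    exists U V, open U /\ open V /\ U y /\ V x /\ forall z, ~ (U z /\ V z)).
  { intros x y [U [V [OU [OV [Ux [Vy D]]]]]]. exists V, U. repeat split; auto; try apply OV;
      try apply OU. intros z [H1 H2]. now apply (D z). }
  intros [[i k] |] [[j k'] |] N; [| | | easy].
  - destruct (classic (j = i)) as [-> | Nij].
    + destruct (HK i k k') as [U [V [OU [OV [Uk [Vk D]]]]]]; [now intros -> |].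
      exists (img i U), (img i V). split; [now apply Oimg |]. split; [now apply Oimg |].
      split; [now exists k |]. split; [now exists k' |].
      intros z [[k1 [U1 E1]] [k2 [V2 E2]]]. rewrite E1 in E2. injection E2 as E2.
      apply sum_in_inj in E2. subst k2. now apply (D k1).
    + apply (Hout i); [now exists k |]. intros [k1 [_ E]]. injection E as E. contradiction.
  - apply (Hout i); [now exists k |]. intros [k1 [_ E]]. discriminate.
  - apply Hsym, (Hout j); [now exists k' |]. intros [k1 [_ E]]. discriminate.
Qed.

End OnePoint.

Definition scattered_paracompact_compactum (K : Top) : Prop :=
  compact K /\ hausdorff K /\ scattered K /\ hereditarily_paracompact K.

Lemma one_point_scattered_paracompact_compactum (I : Type) (K : I -> Top) :
  (forall i, scattered_paracompact_compactum (K i)) ->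
  scattered_paracompact_compactum (one_point I K).
Proof.
  intros HK.
  assert (C := one_point_compact I K (fun i => proj1 (HK i))).
  assert (T2 := one_point_hausdorff I K (fun i => proj1 (proj2 (HK i)))).
  assert (Hrem : forall p q : one_point I K,
    (forall s, Some s <> p) -> (forall s, Some s <> q) -> p = q).
  { intros [s |] [t |] Np Nq; [destruct (Np s) | destruct (Np s) | destruct (Nq t) |]; reflexivity. }
  split; [exact C |]. split; [exact T2 |]. split.
  - apply (sum_extension_scattered I K (one_point I K) Some T2 (one_point_embedding I K) Hrem).
    intros i; apply HK.
  - apply (sum_extension_hereditarily_paracompact I K (one_point I K) Some C T2 (one_point_embedding I K)
      (fun i => proj1 (HK i)) Hrem). intros i; apply HK.
Qed.

Section ScatteredMetrizable.
Context (X : Top).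

(* The open set [C] embeds into [K]; only the values of [g] on [C] matter, and injectivity
   follows from the second condition when [X] is T1. *)
Definition embeds_in (C : X -> Prop) (K : Top) (g : X -> K) : Prop :=
  (forall V, open V -> open (fun x => C x /\ V (g x))) /\
  forall U, open U -> exists V, open V /\ forall x, C x -> (U x <-> V (g x)).

Definition compactifiable (C : X -> Prop) : Prop :=
  exists (K : Top) (g : X -> K), scattered_paracompact_compactum K /\ embeds_in C K g.

(** The embeddings of the pieces are glued into [one_point I K], a point outside all pieces going to
    [None]. The last hypothesis makes such a point unique, separates it from each piece and lets the
    pieces converge to it; it is vacuous for a partition of [C]. *)
Lemma compactifiable_union (C : X -> Prop) (I : Type) (P : I -> X -> Prop) :
  open C -> (forall i, open (P i)) -> (forall i x, P i x -> C x) ->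
  (forall i j x, P i x -> P j x -> i = j) -> (forall i, compactifiable (P i)) ->
  (forall x, C x -> (forall i, ~ P i x) ->
    (forall y, C y -> (forall i, ~ P i y) -> y = x) /\
    (forall i, exists O, open O /\ O x /\ forall y, ~ (O y /\ P i y)) /\
    forall O, open O -> O x -> exists l, forall i, In i l \/ forall y, P i y -> O y) ->
  compactifiable C.
Proof.
  intros OC OP PC Disj HP Hexc.
  apply dep_choice in HP. destruct HP as [K HP]. apply dep_choice in HP. destruct HP as [g Hg].
  destruct (choice (fun x (z : one_point I K) =>
    (forall i, P i x -> z = Some (sum_in I K i (g i x))) /\ ((forall i, ~ P i x) -> z = None)))
    as [G HG].
  { intros x. destruct (classic (exists i, P i x)) as [[i Px] | N].
    - exists (Some (sum_in I K i (g i x))). split.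
      + intros j Pj. now rewrite (Disj i j x Px Pj).
      + intros N. destruct (N i Px).
    - exists None. split; [| reflexivity]. intros i Px. destruct N. now exists i. }
  exists (one_point I K), G.
  split; [apply one_point_scattered_paracompact_compactum; intros i; apply Hg |]. split.
  - intros V [OV LV]. apply open_nbhd. intros x [Cx Vx].
    destruct (classic (exists i, P i x)) as [[i Px] | N].
    + rewrite (proj1 (HG x) i Px) in Vx.
      exists (fun y => P i y /\ V (Some (sum_in I K i (g i y)))).
      split; [exact (proj1 (proj2 (Hg i)) _ (OV i)) |]. split; [now split |].
      intros y [Py Vy]. split; [now apply (PC i) |]. now rewrite (proj1 (HG y) i Py).
    + assert (Nx : forall i, ~ P i x) by (intros i Px; apply N; now exists i).
      rewrite (proj2 (HG x) Nx) in Vx. destruct (LV Vx) as [l Hl].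
      (* All summands outside [l] lie in [V]; the finitely many pieces with index in [l] are avoided
         by the sets [O i]. *)
      destruct (Hexc x Cx Nx) as [_ [Hsep _]]. apply choice in Hsep. destruct Hsep as [O HO].
      exists (fun y => C y /\ forall i, In i l -> O i y).
      split; [apply open_inter; [exact OC |]; apply open_forall_list; intros i _; apply HO |].
      split; [split; [exact Cx |]; intros i _; apply HO |].
      intros y [Cy Hy]. split; [exact Cy |].
      destruct (classic (exists i, P i y)) as [[i Py] | Ny].
      * rewrite (proj1 (HG y) i Py). destruct (Hl i (g i y)) as [Hi | H]; [| exact H].
        destruct (proj2 (proj2 (HO i)) y). split; [now apply Hy | exact Py].
      * rewrite (proj2 (HG y)); [exact Vx |]. intros i Py. apply Ny. now exists i.
  - intros U OU.
    assert (HV : forall i, exists V : K i -> Prop, open V /\ forall x, P i x -> (U x <-> V (g i x))).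
    { intros i. exact (proj2 (proj2 (Hg i)) U OU). }
    apply dep_choice in HV. destruct HV as [V HV].
    (* The image of [P i] need not fill [K i], so whole summands are added when [P i] lies in [U];
       this makes the set a neighborhood of [None] when it has to be one. *)
    exists (fun z : one_point I K => match z with
      | Some s => V (projT1 s) (projT2 s) \/ forall y, P (projT1 s) y -> U y
      | None => exists x, (C x /\ U x) /\ forall i, ~ P i x end).
    split; [split |].
    + intros i. simpl. apply open_or; [apply HV | apply open_const].
    + intros [x [[Cx Ux] Nx]]. destruct (Hexc x Cx Nx) as [_ [_ Hbase]].
      destruct (Hbase U OU Ux) as [l Hl]. exists l. intros i k. simpl.
      destruct (Hl i); tauto.
    + intros x Cx. destruct (classic (exists i, P i x)) as [[i Px] | N].
      * rewrite (proj1 (HG x) i Px). simpl. split; [intros Ux; left; now apply HV |].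
        intros [Vx | S]; [now apply HV in Vx | now apply S].
      * assert (Nx : forall i, ~ P i x) by (intros i Px; apply N; now exists i).
        rewrite (proj2 (HG x) Nx). split; [intros Ux; now exists x |].
        intros [y [[Cy Uy] Ny]]. now rewrite <- (proj1 (Hexc x Cx Nx) y Cy Ny).
Qed.

Lemma scattered_metrizable_compactifiable :
  scattered X -> metrizable X -> compactifiable (fun _ => True).
Proof.
  intros HS [d [d_pos [d_zero [d_sym [d_tri d_open]]]]].
  pose proof (scattered_metric_clopen_base X d d_pos d_zero d_sym d_tri d_open HS) as Hbase.
  pose proof (scattered_metric_ultraparacompact_on X d d_pos d_zero d_sym d_tri d_open HS) as HU.
  set (ok := fun U : X -> Prop => clopen X U /\
    forall C, clopen X C -> (forall y, C y -> U y) -> compactifiable C).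
  (* Labels not taken on [C] give empty cells, handled as unions of no pieces. *)
  assert (Hempty : forall P : X -> Prop, (forall x, ~ P x) -> compactifiable P).
  { intros P N. apply (compactifiable_union P False (fun _ _ => True)); try easy.
    - eapply open_ext; [| apply (open_const X False)]. intros x; split; [easy | apply N].
    - intros x Px. destruct (N x Px). }
  assert (Hpart : forall C, clopen X C -> (forall y, C y -> exists U, ok U /\ U y) ->
    compactifiable C).
  { intros C [OC CC] HC. destruct (HU C OC ok) as [f Hf].
    - intros U [[OU _] _]. exact OU.
    - exact HC.
    - apply (compactifiable_union C (X -> Prop) (fun t x => C x /\ f x = t)); [exact OC | | | | |].
      + intros t. destruct (classic (exists x, C x /\ f x = t)) as [[x [Cx <-]] | N].
        * now apply Hf.
        * eapply open_ext; [| apply (open_const X False)]. intros x; split; [easy |].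
          intros H. apply N. now exists x.
      + tauto.
      + intros t t' x [_ <-] [_ <-]. reflexivity.
      + intros t. destruct (classic (exists x, C x /\ f x = t)) as [[x [Cx <-]] | N].
        * destruct (proj2 Hf x Cx) as [U [[CU HU'] S]]. apply HU'; [| intros y [Cy E]; now apply S].
          apply (open_partition_fiber_clopen X C C _ f _ x Hf CC); auto.
        * apply Hempty. intros x Hx. apply N. now exists x.
      + intros x Cx N. destruct (N (f x)). now split. }
  assert (Hok : forall x : X, exists U, ok U /\ U x).
  { apply NNPP; intros N. apply not_all_ex_not in N.
    destruct (HS _ N) as [x [Bx [V [HV [Vx Iso]]]]]. apply Bx.
    destruct (Hbase x V HV Vx) as [U [CU [Ux [SU _]]]].
    exists U. split; [| exact Ux]. split; [exact CU |]. intros C CC SC.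
    (* Points of [D] lie in [V] and differ from [x], the only bad point there, so [ok] sets cover
       [D]. *)
    assert (Hgood : forall D, clopen X D -> (forall y, D y -> C y /\ y <> x) -> compactifiable D).
    { intros D CD SD. apply Hpart; [exact CD |]. intros y Dy. apply NNPP; intros By.
      apply (SD y Dy), Iso; [exact By | apply SU, SC, SD, Dy]. }
    destruct (classic (C x)) as [Cx | Nx].
    2: { apply Hgood; [exact CC |]. intros y Cy. split; [exact Cy |]. now intros ->. }
    destruct (choice (fun n (N : X -> Prop) => clopen X N /\ N x /\
      forall y, N y -> d x y < / INR (S n))) as [B HB].
    { intros n. destruct (Hbase x (fun y => d x y < / INR (S n))) as [G [CG [Gx [SG _]]]].
      - exact (ball_open X d d_tri d_open x _).
      - rewrite (metric_self X d d_zero). apply inv_succ_positive.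
      - now exists G. }
    (* the ring [P n]: the points for which [B n] is the first base member to miss them *)
    set (P := fun n y => (C y /\ ~ B n y) /\ forall m, In m (seq 0 n) -> B m y).
    assert (CP : forall n, clopen X (P n)).
    { intros n. apply clopen_and; [apply clopen_and; [exact CC |]; apply clopen_not, HB |].
      apply clopen_forall_list. intros m _. apply HB. }
    assert (Pcov : forall y, C y -> y <> x -> exists n, P n y).
    { intros y Cy Ny. destruct (least_nat (fun n => ~ B n y)) as [n [Nn L]].
      - destruct (inv_succ_small (d x y)) as [n Hn].
        + apply (metric_positive X d d_pos d_zero). now intros ->.
        + exists n. intros By. apply HB in By. lra.
      - exists n. split; [now split |]. intros m Hm. apply NNPP. apply L. apply in_seq in Hm. lia. }
    assert (Px : forall y, C y -> (forall n, ~ P n y) -> y = x).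
    { intros y Cy Ny. apply NNPP; intros Nyx. destruct (Pcov y Cy Nyx) as [n Pn].
      exact (Ny n Pn). }
    apply (compactifiable_union C nat P); [apply CC | intros n; apply CP | | | |].
    - intros n y Hy. apply Hy.
    - intros n m y [[_ Nn] Ln] [[_ Nm] Lm].
      destruct (Nat.lt_trichotomy n m) as [H | [H | H]]; [| exact H |].
      + destruct Nn. apply Lm, in_seq. lia.
      + destruct Nm. apply Ln, in_seq. lia.
    - intros n. apply Hgood; [apply CP |]. intros y [[Cy Ny] _]. split; [exact Cy |].
      intros ->. apply Ny, HB.
    - intros y Cy Ny. rewrite (Px y Cy Ny). split; [exact Px |]. split.
      + intros n. exists (B n). split; [apply HB |]. split; [apply HB |].
        intros z [Bz [[_ Nz] _]]. contradiction.
      + intros O OO Ox. destruct (proj1 (d_open O) OO x Ox) as [r [Hr Br]].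
        (* Rings with index above [m] lie in [B m], hence in [O]; the possible exceptions are [0] to
           [m] inclusive. *)
        destruct (inv_succ_small r Hr) as [m Hm]. exists (seq 0 (S m)). intros n.
        destruct (Nat.le_gt_cases n m) as [L | L]; [left; apply in_seq; lia | right].
        intros z [_ Lz]. apply Br. assert (Bz : B m z) by (apply Lz, in_seq; lia).
        apply HB in Bz. lra. }
  apply Hpart; [apply clopen_full | auto].
Qed.

End ScatteredMetrizable.

Lemma scattered_metrizable_compactification (X : Top) :
  scattered X -> metrizable X ->
  exists (K : Top) (e : X -> K),
    compactification X K e /\ scattered K /\ hereditarily_paracompact K.
Proof.
  intros HS HM.
  destruct (scattered_metrizable_compactifiable X HS HM) as [K [g [[C [T2 [S HP]]] [g_cont g_open]]]].
  (* Density of the image is obtained by passing from [K] to the closure [Z] of the image. *)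
  set (Z := fun k : K => forall O, open O -> O k -> exists k', O k' /\ exists x, g x = k').
  assert (gZ : forall x, Z (g x)).
  { intros x O _ Ox. exists (g x). split; [exact Ox | now exists x]. }
  exists (subspace K Z), (fun x => exist _ (g x) (gZ x)).
  split; [split; [| split; [| split]] |].
  - apply subspace_closed_compact; [exact C | apply closure_closed].
  - now apply subspace_hausdorff.
  - split; [| split].
    + intros V [V' [OV EV]]. eapply open_ext; [| exact (g_cont V' OV)].
      intros x; simpl. rewrite EV. simpl. tauto.
    + intros x y E. apply (f_equal (@proj1_sig _ _)) in E. simpl in E.
      destruct HM as [d [d_pos [d_zero [_ [_ d_open]]]]].
      apply NNPP; intros N.
      destruct (g_open _ (metric_T1 X d d_pos d_zero d_open y)) as [V [_ HV]].
      apply (HV y Logic.I); [| reflexivity]. rewrite <- E. now apply (HV x).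
    + intros U OU. destruct (g_open U OU) as [V [OV HV]].
      exists (fun z => V (proj1_sig z)). split; [now exists V |]. intros x. now apply HV.
  - intros V [V' [OV EV]] [[k Zk] Vk]. apply EV in Vk.
    destruct (Zk V' OV Vk) as [k' [Vk' [x <-]]]. exists x. now apply EV.
  - split; [now apply subspace_scattered | now apply subspace_hereditarily_paracompact].
Qed.

(** * Unordered sums and the Hilbert space of square summable families *)

Definition lsum (T : Type) (f : T -> R) (l : list T) : R := fold_right (fun a s => f a + s) 0 l.

Section Sums.
Context (T : Type).
Implicit Types (f g : T -> R) (l : list T).

Lemma lsum_perm f l l' : Permutation l l' -> lsum T f l = lsum T f l'.
Proof. induction 1; simpl; lra. Qed.

Lemma lsum_app f l l' : lsum T f (l ++ l') = lsum T f l + lsum T f l'.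
Proof. induction l; simpl; lra. Qed.

Lemma lsum_lin f g a b l : lsum T (fun t => a * f t + b * g t) l = a * lsum T f l + b * lsum T g l.
Proof. induction l as [| t l IH]; simpl; [lra | rewrite IH; lra]. Qed.

Lemma lsum_le f g l : (forall t, In t l -> f t <= g t) -> lsum T f l <= lsum T g l.
Proof.
  induction l as [| t l IH]; intros H; simpl; [lra |].
  pose proof (H t (or_introl eq_refl)). assert (lsum T f l <= lsum T g l); [| lra].
  apply IH. intros u Hu. apply H. now right.
Qed.

Lemma lsum_ext f g l : (forall t, In t l -> f t = g t) -> lsum T f l = lsum T g l.
Proof. intros H. apply Rle_antisym; apply lsum_le; intros t Ht; rewrite (H t Ht); lra. Qed.

Lemma lsum_zero l : lsum T (fun _ => 0) l = 0.
Proof. induction l; simpl; lra. Qed.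

Lemma lsum_nonneg f l : (forall t, 0 <= f t) -> 0 <= lsum T f l.
Proof. intros H. rewrite <- (lsum_zero l). now apply lsum_le. Qed.

Lemma incl_permutation l l' :
  NoDup l -> incl l l' -> exists l'', Permutation l' (l ++ l'').
Proof.
  revert l'. induction l as [| t l IH]; intros l' ND Hincl; [now exists l' |].
  inversion ND as [| ? ? Nt ND']; subst.
  destruct (in_split t l') as [l1 [l2 ->]]; [apply Hincl; now left |].
  destruct (IH (l1 ++ l2) ND') as [l'' P].
  - intros u Hu. assert (H : In u (l1 ++ t :: l2)) by (apply Hincl; now right).
    apply in_app_iff in H. apply in_app_iff. destruct H as [H | [<- | H]]; auto. contradiction.
  - exists l''. simpl. rewrite <- P. symmetry. apply Permutation_middle.
Qed.

(** Duplicate-free lists are directed under inclusion; they index the partial sums below. *)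
Lemma nodup_incl l l' : exists m, NoDup m /\ incl l m /\ incl l' m.
Proof.
  exists (nodup (fun x y : T => excluded_middle_informative (x = y)) (l ++ l')).
  split; [apply NoDup_nodup |].
  split; intros t Ht; apply nodup_In, in_app_iff; auto.
Qed.

(** Unconditional summation: convergence of the net of sums over finite sets. *)
Definition has_sum f (s : R) : Prop :=
  forall eps, 0 < eps ->
    exists l0, forall l, NoDup l -> incl l0 l -> Rabs (lsum T f l - s) < eps.

Lemma has_sum_unique f s s' : has_sum f s -> has_sum f s' -> s = s'.
Proof.
  intros H H'. apply NNPP; intros N.
  assert (P : 0 < Rabs (s - s') / 2) by (pose proof (Rabs_pos_lt (s - s')); lra).
  destruct (H _ P) as [l Hl], (H' _ P) as [l' Hl'].
  destruct (nodup_incl l l') as [m [ND [I1 I2]]].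
  specialize (Hl m ND I1). specialize (Hl' m ND I2).
  revert Hl Hl' P. unfold Rabs. repeat destruct Rcase_abs; lra.
Qed.

Lemma has_sum_lin f g s s' a b :
  has_sum f s -> has_sum g s' -> has_sum (fun t => a * f t + b * g t) (a * s + b * s').
Proof.
  intros H H' eps He.
  pose proof (Rabs_pos a) as Pa. pose proof (Rabs_pos b) as Pb.
  destruct (H (eps / (2 * (Rabs a + 1)))) as [l Hl].
  { apply Rdiv_lt_0_compat; lra. }
  destruct (H' (eps / (2 * (Rabs b + 1)))) as [l' Hl'].
  { apply Rdiv_lt_0_compat; lra. }
  exists (l ++ l'). intros m ND Im.
  specialize (Hl m ND (fun t Ht => Im t (in_or_app _ _ _ (or_introl Ht)))).
  specialize (Hl' m ND (fun t Ht => Im t (in_or_app _ _ _ (or_intror Ht)))).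
  rewrite lsum_lin.
  replace (a * lsum T f m + b * lsum T g m - (a * s + b * s'))
    with (a * (lsum T f m - s) + b * (lsum T g m - s')) by ring.
  eapply Rle_lt_trans; [apply Rabs_triang |]. rewrite !Rabs_mult.
  assert (A : Rabs a * Rabs (lsum T f m - s) <= (Rabs a) * (eps / (2 * (Rabs a + 1)))).
  { apply Rmult_le_compat_l; lra. }
  assert (B : Rabs b * Rabs (lsum T g m - s') <= (Rabs b) * (eps / (2 * (Rabs b + 1)))).
  { apply Rmult_le_compat_l; lra. }
  assert (Half : forall c, 0 <= c -> c * (eps / (2 * (c + 1))) < eps / 2).
  { intros c Hc. assert (0 < eps / (2 * (c + 1))) by (apply Rdiv_lt_0_compat; lra).
    replace (eps / 2) with ((c + 1) * (eps / (2 * (c + 1)))) by (field; lra). lra. }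
  pose proof (Half _ Pa). pose proof (Half _ Pb). lra.
Qed.

Lemma has_sum_nonneg_partial f s l :
  (forall t, 0 <= f t) -> has_sum f s -> NoDup l -> lsum T f l <= s.
Proof.
  intros Hf Hs ND. apply Rnot_lt_le. intros L.
  destruct (Hs (lsum T f l - s)) as [l0 H0]; [lra |].
  destruct (nodup_incl l l0) as [m [NDm [I1 I2]]]. specialize (H0 m NDm I2).
  destruct (incl_permutation l m ND I1) as [l'' P].
  rewrite (lsum_perm f _ _ P), lsum_app in H0. pose proof (lsum_nonneg f l'' Hf).
  revert H0. unfold Rabs. destruct Rcase_abs; lra.
Qed.

Lemma has_sum_le f s B :
  has_sum f s -> (forall l, NoDup l -> lsum T f l <= B) -> s <= B.
Proof.
  intros Hs HB. apply Rnot_lt_le. intros L.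
  destruct (Hs (s - B)) as [l0 H0]; [lra |].
  destruct (nodup_incl l0 l0) as [m [ND [I1 _]]]. specialize (H0 m ND I1). specialize (HB m ND).
  revert H0. unfold Rabs. destruct Rcase_abs; lra.
Qed.

(** Partial sums of a nonnegative family grow with the finite set, so they converge to their
    supremum. *)
Lemma has_sum_bounded f B :
  (forall t, 0 <= f t) -> (forall l, NoDup l -> lsum T f l <= B) -> exists s, has_sum f s.
Proof.
  intros Hf HB.
  destruct (completeness (fun r => exists l, NoDup l /\ lsum T f l = r)) as [s [Us Ls]].
  - exists B. intros r [l [ND <-]]. now apply HB.
  - exists 0, nil. split; [constructor | reflexivity].
  - exists s. intros eps He.
    assert (H : exists l, NoDup l /\ s - eps < lsum T f l).
    { apply NNPP; intros N. assert (s <= s - eps); [| lra]. apply Ls.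
      intros r [l [ND <-]]. apply Rnot_lt_le. intros L. apply N. now exists l. }
    destruct H as [l [ND L]]. exists l. intros m NDm Im.
    destruct (incl_permutation l m ND Im) as [l'' P].
    assert (lsum T f m <= s) by (apply Us; now exists m).
    rewrite (lsum_perm f _ _ P), lsum_app in *. pose proof (lsum_nonneg f l'' Hf).
    unfold Rabs. destruct Rcase_abs; lra.
Qed.

Definition square_summable (v : T -> R) : Prop :=
  exists B, forall l, NoDup l -> lsum T (fun t => v t * v t) l <= B.

Lemma square_summable_lin (v w : T -> R) (a b : R) :
  square_summable v -> square_summable w -> square_summable (fun t => a * v t + b * w t).
Proof.
  (* The constants come from expanding the square of [a * v t - b * w t], which is nonnegative. *)
  intros [B HB] [B' HB']. exists (2 * (a * a) * B + 2 * (b * b) * B'). intros l ND.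
  apply Rle_trans with
    (lsum T (fun t => 2 * (a * a) * (v t * v t) + 2 * (b * b) * (w t * w t)) l).
  - apply lsum_le. intros t _. pose proof (Rle_0_sqr (a * v t - b * w t)). unfold Rsqr in *. lra.
  - rewrite (lsum_lin (fun t => v t * v t) (fun t => w t * w t)).
    specialize (HB l ND). specialize (HB' l ND).
    pose proof (Rle_0_sqr a). pose proof (Rle_0_sqr b). unfold Rsqr in *.
    apply Rplus_le_compat; apply Rmult_le_compat_l; lra.
Qed.

Lemma square_summable_sum (v : T -> R) :
  square_summable v -> exists s, has_sum (fun t => v t * v t) s.
Proof.
  intros [B HB]. apply (has_sum_bounded _ B); [| exact HB].
  intros t. pose proof (Rle_0_sqr (v t)). unfold Rsqr in *. lra.
Qed.

Definition l2_carrier : Type := {v : T -> R | square_summable v}.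

(** Sum, scalar multiple and opposite all derive from this one operation, so square summability and
    linearity of the inner product are each proved once. *)
Definition l2_lin (a b : R) (x y : l2_carrier) : l2_carrier :=
  exist _ (fun t => a * proj1_sig x t + b * proj1_sig y t)
    (square_summable_lin _ _ a b (proj2_sig x) (proj2_sig y)).

Lemma square_summable_zero : square_summable (fun _ => 0).
Proof.
  exists 0. intros l _. rewrite (lsum_ext _ (fun _ => 0)) by (intros; ring). rewrite lsum_zero. lra.
Qed.

Definition l2_zero : l2_carrier := exist _ (fun _ => 0) square_summable_zero.
Definition l2_add (x y : l2_carrier) : l2_carrier := l2_lin 1 1 x y.
Definition l2_scal (a : R) (x : l2_carrier) : l2_carrier := l2_lin a 0 x x.
Definition l2_opp (x : l2_carrier) : l2_carrier := l2_scal (-1) x.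

Lemma l2_ext (x y : l2_carrier) : (forall t, proj1_sig x t = proj1_sig y t) -> x = y.
Proof. intros H. apply sig_ext. now apply functional_extensionality. Qed.

(* By polarization, [x t * y t] is a combination of two squares of square summable families. *)
Lemma l2_product_sum (x y : l2_carrier) :
  exists s, has_sum (fun t => proj1_sig x t * proj1_sig y t) s.
Proof.
  destruct (square_summable_sum _ (proj2_sig (l2_lin 1 1 x y))) as [s Hs].
  destruct (square_summable_sum _ (proj2_sig (l2_lin 1 (-1) x y))) as [s' Hs'].
  exists (/ 4 * s + - / 4 * s').
  pose proof (has_sum_lin _ _ _ _ (/ 4) (- / 4) Hs Hs') as H.
  replace (fun t => proj1_sig x t * proj1_sig y t) with
    (fun t => / 4 * (proj1_sig (l2_lin 1 1 x y) t * proj1_sig (l2_lin 1 1 x y) t) +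
      - / 4 * (proj1_sig (l2_lin 1 (-1) x y) t * proj1_sig (l2_lin 1 (-1) x y) t)); [exact H |].
  apply functional_extensionality. intros t. simpl. field.
Qed.

Definition l2_inner (x y : l2_carrier) : R :=
  proj1_sig (constructive_indefinite_description _ (l2_product_sum x y)).

Lemma l2_inner_sum (x y : l2_carrier) :
  has_sum (fun t => proj1_sig x t * proj1_sig y t) (l2_inner x y).
Proof. exact (proj2_sig (constructive_indefinite_description _ (l2_product_sum x y))). Qed.

Lemma l2_inner_sym x y : l2_inner x y = l2_inner y x.
Proof.
  apply (has_sum_unique _ _ _ (l2_inner_sum x y)).
  replace (fun t => proj1_sig x t * proj1_sig y t) with
    (fun t => proj1_sig y t * proj1_sig x t); [apply l2_inner_sum |].
  apply functional_extensionality. intros t. ring.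
Qed.

Lemma l2_inner_lin a b x y z :
  l2_inner (l2_lin a b x y) z = a * l2_inner x z + b * l2_inner y z.
Proof.
  apply (has_sum_unique _ _ _ (l2_inner_sum _ z)).
  pose proof (has_sum_lin _ _ _ _ a b (l2_inner_sum x z) (l2_inner_sum y z)) as H.
  replace (fun t => proj1_sig (l2_lin a b x y) t * proj1_sig z t) with
    (fun t => a * (proj1_sig x t * proj1_sig z t) + b * (proj1_sig y t * proj1_sig z t));
    [exact H |].
  apply functional_extensionality. intros t. simpl. ring.
Qed.

Lemma square_nonneg (v : T -> R) t : 0 <= v t * v t.
Proof. exact (Rle_0_sqr (v t)). Qed.

Lemma l2_partial x l :
  NoDup l -> lsum T (fun t => proj1_sig x t * proj1_sig x t) l <= l2_inner x x.
Proof.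
  intros ND. apply has_sum_nonneg_partial; [apply square_nonneg | apply l2_inner_sum | exact ND].
Qed.

Lemma l2_inner_pos x : 0 <= l2_inner x x.
Proof. exact (l2_partial x nil (NoDup_nil T)). Qed.

Lemma l2_coord_sqr x t : proj1_sig x t * proj1_sig x t <= l2_inner x x.
Proof.
  pose proof (l2_partial x (t :: nil)) as H. simpl in H.
  assert (NoDup (t :: nil)) by (constructor; [easy | constructor]). specialize (H H0). lra.
Qed.

Lemma l2_coord x t : Rabs (proj1_sig x t) <= sqrt (l2_inner x x).
Proof. rewrite <- sqrt_Rsqr_abs. apply sqrt_le_1_alt, l2_coord_sqr. Qed.

Lemma l2_inner_def x : l2_inner x x = 0 -> x = l2_zero.
Proof.
  intros H. apply l2_ext. intros t. simpl. pose proof (l2_coord_sqr x t). nra.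
Qed.

Lemma lsum_limit (u : nat -> T -> R) (v : T -> R) (w : T -> R) l :
  (forall t, Un_cv (fun n => u n t) (v t)) ->
  Un_cv (fun n => lsum T (fun t => (w t - u n t) * (w t - u n t)) l)
    (lsum T (fun t => (w t - v t) * (w t - v t)) l).
Proof.
  intros H. induction l as [| t l IH]; simpl.
  - intros eps He. exists 0%nat. intros n _. now rewrite R_dist_eq.
  - assert (D : Un_cv (fun n => w t - u n t) (w t - v t)).
    { apply (CV_minus (fun _ => w t)); [| apply H].
      intros eps He. exists 0%nat. intros n _. now rewrite R_dist_eq. }
    apply (CV_plus (fun n => (w t - u n t) * (w t - u n t))); [| exact IH].
    now apply (CV_mult (fun n => w t - u n t) (fun n => w t - u n t)).
Qed.

Lemma Un_cv_upper (u : nat -> R) s B N :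
  Un_cv u s -> (forall n, (N <= n)%nat -> u n <= B) -> s <= B.
Proof.
  intros H HB. apply Rnot_lt_le. intros L. destruct (H (s - B)) as [M HM]; [lra |].
  specialize (HM (max N M) (Nat.le_max_r _ _)). specialize (HB (max N M) (Nat.le_max_l _ _)).
  revert HM. unfold R_dist, Rdist, Rabs. destruct Rcase_abs; lra.
Qed.

(** The limit is taken coordinatewise. The Cauchy bounds pass to the limit in finite partial sums,
    and [has_sum_le] carries them over to the norm. *)
Lemma l2_complete (u : nat -> l2_carrier) :
  (forall eps, 0 < eps -> exists N, forall m n, (N <= m)%nat -> (N <= n)%nat ->
    sqrt (l2_inner (l2_add (u m) (l2_opp (u n))) (l2_add (u m) (l2_opp (u n)))) < eps) ->
  exists y, forall eps, 0 < eps -> exists N, forall n, (N <= n)%nat ->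
    sqrt (l2_inner (l2_add (u n) (l2_opp y)) (l2_add (u n) (l2_opp y))) < eps.
Proof.
  intros HC.
  assert (Hlim : forall t, exists r, Un_cv (fun n => proj1_sig (u n) t) r).
  { intros t. destruct (R_complete (fun n => proj1_sig (u n) t)) as [r Hr]; [| now exists r].
    intros eps He. destruct (HC eps He) as [N HN]. exists N. intros m n Hm Hn.
    eapply Rle_lt_trans; [| exact (HN m n Hm Hn)]. eapply Rle_trans; [| apply (l2_coord _ t)].
    simpl. unfold R_dist, Rdist. right. f_equal. ring. }
  apply choice in Hlim. destruct Hlim as [v Hv].
  assert (Htail : forall eps, 0 < eps -> exists N, forall n, (N <= n)%nat -> forall l, NoDup l ->
    lsum T (fun t => (proj1_sig (u n) t - v t) * (proj1_sig (u n) t - v t)) l <= eps * eps).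
  { intros eps He. destruct (HC eps He) as [N HN]. exists N. intros n Hn l ND.
    apply (Un_cv_upper _ _ _ N (lsum_limit (fun m => proj1_sig (u m)) v (proj1_sig (u n)) l Hv)).
    intros m Hm. specialize (HN n m Hn Hm).
    pose proof (l2_inner_pos (l2_add (u n) (l2_opp (u m)))) as P.
    pose proof (l2_partial (l2_add (u n) (l2_opp (u m))) l ND) as Q.
    apply Rle_trans with (l2_inner (l2_add (u n) (l2_opp (u m))) (l2_add (u n) (l2_opp (u m)))).
    - eapply Rle_trans; [| exact Q]. right. apply lsum_ext. intros t _. simpl. ring.
    - rewrite <- (sqrt_sqrt _ P). pose proof (sqrt_pos
        (l2_inner (l2_add (u n) (l2_opp (u m))) (l2_add (u n) (l2_opp (u m))))). nra. }
  assert (Sv : square_summable v).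
  { destruct (Htail 1) as [N HN]; [lra |].
    pose proof (square_summable_lin (proj1_sig (u N)) (fun t => proj1_sig (u N) t - v t) 1 (-1)
      (proj2_sig (u N))) as H.
    replace v with (fun t => 1 * proj1_sig (u N) t + -1 * (proj1_sig (u N) t - v t)).
    - apply H. exists (1 * 1). intros l ND. now apply HN.
    - apply functional_extensionality. intros t. ring. }
  (* Limits preserve only non-strict bounds, hence [eps / 2]. *)
  exists (exist _ v Sv). intros eps He. destruct (Htail (eps / 2)) as [N HN]; [lra |].
  exists N. intros n Hn. apply Rle_lt_trans with (eps / 2); [| lra].
  rewrite <- (sqrt_square (eps / 2)); [| lra]. apply sqrt_le_1_alt.
  apply (has_sum_le _ _ _ (l2_inner_sum _ _)). intros l ND.
  eapply Rle_trans; [| exact (HN n Hn l ND)]. right. apply lsum_ext. intros t _. simpl. ring.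
Qed.

Definition l2 : Hilbert.
Proof.
  refine {| hv := l2_carrier; hzero := l2_zero; hadd := l2_add; hopp := l2_opp; hscal := l2_scal;
    hinner := l2_inner; hinner_sym := l2_inner_sym; hinner_pos := l2_inner_pos;
    hinner_def := l2_inner_def; hcomplete := l2_complete |};
  intros; try (apply l2_ext; intros t; simpl; ring);
  unfold l2_add, l2_scal; rewrite l2_inner_lin; ring.
Defined.

(** * Weak continuity into the space of square summable families *)

Definition l2_single (t0 : T) : l2_carrier.
Proof.
  exists (fun t => if excluded_middle_informative (t = t0) then 1 else 0).
  exists 1. intros l ND. induction l as [| t l IH]; simpl; [lra |].
  inversion ND as [| ? ? Nt ND']; subst. destruct (excluded_middle_informative (t = t0)) as [-> | N].
  - assert (E : lsum T (fun t => (if excluded_middle_informative (t = t0) then 1 else 0) *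
      (if excluded_middle_informative (t = t0) then 1 else 0)) l = 0); [| rewrite E; lra].
    transitivity (lsum T (fun _ => 0) l); [| apply lsum_zero]. apply lsum_ext. intros t Ht.
    destruct (excluded_middle_informative (t = t0)) as [-> | _]; [contradiction | ring].
  - specialize (IH ND'). lra.
Defined.

Lemma l2_inner_single t0 x : l2_inner (l2_single t0) x = proj1_sig x t0.
Proof.
  apply (has_sum_unique _ _ _ (l2_inner_sum _ x)). intros eps He. exists (t0 :: nil).
  intros l ND Il. destruct (in_split t0 l) as [l1 [l2' ->]]; [apply Il; now left |].
  assert (P : Permutation (l1 ++ t0 :: l2') (t0 :: l1 ++ l2')) by
    (symmetry; apply Permutation_middle).
  rewrite (lsum_perm _ _ _ P). apply (Permutation_NoDup P) in ND.
  inversion ND as [| ? ? Nt _]; subst. simpl.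
  rewrite (lsum_ext _ (fun _ => 0)).
  - rewrite lsum_zero. destruct (excluded_middle_informative (t0 = t0)) as [_ | N]; [| easy].
    replace (1 * proj1_sig x t0 + 0 - proj1_sig x t0) with 0 by ring. now rewrite Rabs_R0.
  - intros t Ht. destruct (excluded_middle_informative (t = t0)) as [-> | _]; [contradiction | ring].
Qed.

Definition l2_finite (b : T -> R) (l : list T) : l2_carrier :=
  fold_right (fun t y => l2_add (l2_scal (b t) (l2_single t)) y) l2_zero l.

Lemma l2_linear_finite (phi : l2_carrier -> R) b l :
  bounded_linear l2 phi ->
  phi (l2_finite b l) = lsum T (fun t => b t * phi (l2_single t)) l.
Proof.
  intros [Hadd [Hscal _]]. induction l as [| t l IH]; simpl.
  - pose proof (Hscal 0 l2_zero) as H. simpl in H.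
    replace (l2_scal 0 l2_zero) with l2_zero in H by (apply l2_ext; intros; simpl; ring). lra.
  - change (l2_add ?x ?y) with (hadd l2 x y). rewrite Hadd.
    change (l2_scal ?a ?y) with (hscal l2 a y). rewrite Hscal. now rewrite IH.
Qed.

Lemma l2_inner_bounded_linear y : bounded_linear l2 (fun x => l2_inner x y).
Proof.
  split; [| split].
  - intros x x'. change (hadd l2 x x') with (l2_lin 1 1 x x'). rewrite l2_inner_lin. ring.
  - intros a x. change (hscal l2 a x) with (l2_lin a 0 x x). rewrite l2_inner_lin. ring.
  - exists (sqrt (l2_inner y y)). intros x. unfold hnorm. simpl.
    rewrite <- sqrt_mult, <- sqrt_Rsqr_abs by apply l2_inner_pos. apply sqrt_le_1_alt.
    (* discriminant of [a |-> l2_inner (x + a y) (x + a y)] *)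
    pose proof (fun a b => l2_inner_pos (l2_lin a b x y)) as H.
    assert (E : forall a b, l2_inner (l2_lin a b x y) (l2_lin a b x y) =
      a * a * l2_inner x x + 2 * a * b * l2_inner x y + b * b * l2_inner y y).
    { intros a b. rewrite l2_inner_lin, !(l2_inner_sym _ (l2_lin a b x y)), !l2_inner_lin.
      rewrite (l2_inner_sym y x). ring. }
    (* With these coefficients the form equals [l2_inner y y] times the Cauchy-Schwarz defect, so
       the case of zero norm is treated apart. *)
    pose proof (H (l2_inner y y) (- l2_inner x y)) as H1. rewrite E in H1.
    pose proof (l2_inner_pos y) as Py. pose proof (l2_inner_pos x) as Px. unfold Rsqr.
    destruct (Req_dec (l2_inner y y) 0) as [Z | NZ].
    + apply l2_inner_def in Z. subst y.
      assert (Z : l2_inner x l2_zero = 0).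
      { apply (has_sum_unique _ _ _ (l2_inner_sum x l2_zero)).
        intros eps He. exists nil. intros l _ _. simpl.
        rewrite (lsum_ext _ (fun _ => 0)) by (intros; ring). rewrite lsum_zero.
        now rewrite Rminus_diag, Rabs_R0. }
      rewrite Z. apply Rle_trans with 0; [lra |]. now apply Rmult_le_pos.
    + assert (0 < l2_inner y y) by lra.
      apply Rmult_le_reg_l with (l2_inner y y); [assumption |]. lra.
Qed.

Lemma l2_inner_finite b l y : l2_inner (l2_finite b l) y = lsum T (fun t => b t * proj1_sig y t) l.
Proof.
  rewrite (l2_linear_finite (fun x => l2_inner x y) b l (l2_inner_bounded_linear y)).
  apply lsum_ext. intros t _. now rewrite l2_inner_single.
Qed.

Lemma l2_finite_coord b l t : NoDup l -> In t l -> proj1_sig (l2_finite b l) t = b t.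
Proof.
  intros ND. induction l as [| t' l IH]; intros Ht; [easy |].
  inversion ND as [| ? ? Nt ND']; subst. simpl.
  assert (Z : forall m, ~ In t m -> proj1_sig (l2_finite b m) t = 0).
  { induction m as [| s m IHm]; intros Nm; [reflexivity |]. simpl in *.
    rewrite IHm by tauto. destruct (excluded_middle_informative (t = s)) as [-> | _]; [tauto | ring]. }
  destruct (excluded_middle_informative (t = t')) as [-> | N].
  - rewrite Z by exact Nt. ring.
  - destruct Ht as [-> | Ht]; [easy |]. rewrite (IH ND' Ht). ring.
Qed.

Lemma l2_norm_finite b l :
  NoDup l -> l2_inner (l2_finite b l) (l2_finite b l) = lsum T (fun t => b t * b t) l.
Proof.
  intros ND. rewrite l2_inner_finite. apply lsum_ext. intros t Ht. now rewrite l2_finite_coord.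
Qed.

(* The coefficients of [phi] are square summable, so [phi] is approximated by a finite combination
   of coordinates, uniformly on the unit ball. *)
Lemma bounded_linear_coordinates (phi : l2_carrier -> R) (eps : R) :
  bounded_linear l2 phi -> 0 < eps ->
  exists l, forall x, l2_inner x x <= 1 ->
    Rabs (phi x - lsum T (fun t => proj1_sig x t * phi (l2_single t)) l) <= eps.
Proof.
  intros Hphi Heps. pose proof Hphi as [Hadd [Hscal [C0 HC0]]].
  (* The given [C0] may fail to be positive, and [C] is divided by below. *)
  set (C := Rabs C0 + 1).
  assert (PC : 1 <= C) by (unfold C; pose proof (Rabs_pos C0); lra).
  assert (HC : forall x, Rabs (phi x) <= C * sqrt (l2_inner x x)).
  { intros x. eapply Rle_trans; [apply HC0 |]. unfold hnorm; simpl.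
    apply Rmult_le_compat_r; [apply sqrt_pos |]. unfold C. pose proof (Rle_abs C0). lra. }
  set (a := fun t => phi (l2_single t)).
  (* Evaluating [phi] at the finite combination with coefficients [a] gives [s <= C * sqrt s] for
     the partial sum [s] of squares. *)
  assert (Ha : forall l, NoDup l -> lsum T (fun t => a t * a t) l <= C * C).
  { intros l ND. pose proof (HC (l2_finite a l)) as H.
    rewrite (l2_norm_finite a l ND), (l2_linear_finite phi a l Hphi) in H.
    change (fun t => a t * phi (l2_single t)) with (fun t => a t * a t) in H.
    pose proof (lsum_nonneg _ l (square_nonneg a)) as P.
    rewrite Rabs_right in H by lra. set (s := lsum T (fun t => a t * a t) l) in *.
    pose proof (sqrt_sqrt s P). pose proof (sqrt_pos s). nra. }
  destruct (has_sum_bounded _ _ (square_nonneg a) Ha) as [S HS].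
  assert (Pe : 0 < eps * eps) by now apply Rmult_lt_0_compat.
  destruct (HS (eps * eps / 4)) as [l0 Hl0]; [lra |].
  destruct (nodup_incl l0 l0) as [l [ND [Il _]]]. exists l. intros x Hx.
  set (v := proj1_sig x).
  assert (Pd : 0 < eps / (2 * C)) by (apply Rdiv_lt_0_compat; lra).
  destruct (l2_inner_sum x x (eps / (2 * C) * (eps / (2 * C)))) as [l1 Hl1];
    [now apply Rmult_lt_0_compat |].
  (* [l] depends on [phi] alone, [m] also on [x]. The error splits into the tail over [l''], small
     because the coefficients of [phi] are, and the value of [phi] at [x] minus its truncation to
     [m], small because [phi] is bounded; each is at most [eps / 2]. *)
  destruct (nodup_incl l l1) as [m [NDm [I1 I2]]]. specialize (Hl1 m NDm I2).
  destruct (incl_permutation l m ND I1) as [l'' P].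
  assert (E : lsum T (fun t => v t * a t) m =
    lsum T (fun t => v t * a t) l + lsum T (fun t => v t * a t) l'').
  { now rewrite (lsum_perm _ _ _ P), lsum_app. }
  assert (Htail : Rabs (lsum T (fun t => v t * a t) l'') <= eps / 2).
  { assert (Ta : lsum T (fun t => a t * a t) l'' <= eps * eps / 4).
    { pose proof (Hl0 l ND Il) as H. pose proof (has_sum_nonneg_partial _ _ m (square_nonneg a) HS NDm).
      rewrite (lsum_perm _ _ _ P), lsum_app in *. revert H. unfold Rabs. destruct Rcase_abs; lra. }
    assert (Tv : lsum T (fun t => v t * v t) l'' <= 1).
    { pose proof (l2_partial x m NDm) as H. fold v in H. rewrite (lsum_perm _ _ _ P), lsum_app in H.
      pose proof (lsum_nonneg _ l (square_nonneg v)). lra. }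
    assert (Ie : 0 < / eps) by now apply Rinv_0_lt_compat.
    (* AM-GM: [2 |v a| <= 2 a^2 / eps + eps v^2 / 2] *)
    assert (AG : forall t, Rabs (v t * a t) <= / eps * (a t * a t) + eps / 4 * (v t * v t)).
    { intros t. assert (H : forall c, c = a t \/ c = - a t ->
        v t * c <= / eps * (a t * a t) + eps / 4 * (v t * v t)).
      { intros c Hc. replace (a t * a t) with (c * c) by (destruct Hc as [-> | ->]; ring).
        pose proof (Rle_0_sqr (c - eps / 2 * v t)) as Q. unfold Rsqr in Q.
        apply (Rmult_le_compat_l (/ eps)) in Q; [| lra]. rewrite Rmult_0_r in Q.
        replace (/ eps * ((c - eps / 2 * v t) * (c - eps / 2 * v t))) with
          (/ eps * (c * c) - v t * c + eps / 4 * (v t * v t)) in Q by (field; lra). lra. }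
      unfold Rabs. destruct Rcase_abs; [| apply H; now left].
      rewrite Ropp_mult_distr_r. apply H. now right. }
    assert (B : forall f g : T -> R, (forall t, Rabs (f t) <= g t) ->
      forall k, Rabs (lsum T f k) <= lsum T g k).
    { intros f g H k. induction k as [| t k IH]; simpl; [rewrite Rabs_R0; lra |].
      eapply Rle_trans; [apply Rabs_triang |]. specialize (H t). lra. }
    eapply Rle_trans; [apply (B _ _ AG) |].
    rewrite (lsum_lin (fun t => a t * a t) (fun t => v t * v t)).
    apply (Rmult_le_compat_l (/ eps)) in Ta; [| lra].
    apply (Rmult_le_compat_l (eps / 4)) in Tv; [| lra].
    replace (/ eps * (eps * eps / 4)) with (eps / 4) in Ta by (field; lra). lra. }
  set (y := l2_finite v m).
  assert (Hnorm : l2_inner (l2_lin 1 (-1) x y) (l2_lin 1 (-1) x y) =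
    l2_inner x x - lsum T (fun t => v t * v t) m).
  { rewrite l2_inner_lin, !(l2_inner_sym _ (l2_lin 1 (-1) x y)), !l2_inner_lin.
    rewrite (l2_inner_sym x y). unfold y. rewrite (l2_norm_finite v m NDm), l2_inner_finite.
    fold v. ring. }
  assert (Hdist : Rabs (phi (l2_lin 1 (-1) x y)) <= eps / 2).
  { eapply Rle_trans; [apply HC |]. rewrite Hnorm.
    replace (eps / 2) with (C * (eps / (2 * C))) by (field; lra).
    apply Rmult_le_compat_l; [lra |]. rewrite <- (sqrt_square (eps / (2 * C))) by lra.
    apply sqrt_le_1_alt. fold v in Hl1. revert Hl1. unfold Rabs. destruct Rcase_abs; lra. }
  assert (Ephi : phi (l2_lin 1 (-1) x y) = phi x - lsum T (fun t => v t * a t) m).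
  { replace (l2_lin 1 (-1) x y) with (hadd l2 x (hscal l2 (-1) y)).
    - rewrite Hadd, Hscal. unfold y. rewrite (l2_linear_finite phi v m Hphi).
      unfold a. ring.
    - apply l2_ext. intros t. simpl. ring. }
  rewrite Ephi, E in Hdist. fold v. change (fun t => v t * phi (l2_single t)) with (fun t => v t * a t).
  revert Hdist Htail. unfold Rabs. repeat destruct Rcase_abs; lra.
Qed.

End Sums.

(** * Compact spaces with coordinates in the unit ball *)

Definition real_continuous (K : Top) (g : K -> R) : Prop :=
  forall x r, 0 < r -> exists O, open O /\ O x /\ forall y, O y -> Rabs (g y - g x) < r.

Lemma real_continuous_const (K : Top) (c : R) : real_continuous K (fun _ => c).
Proof.
  intros x r Hr. exists (fun _ => True). split; [apply open_full |]. split; [easy |].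
  intros y _. now rewrite Rminus_diag, Rabs_R0.
Qed.

Lemma real_continuous_lin (K : Top) (f g : K -> R) (a : R) :
  real_continuous K f -> real_continuous K g -> real_continuous K (fun x => a * f x + g x).
Proof.
  intros Hf Hg x r Hr. pose proof (Rabs_pos a) as Pa.
  destruct (Hf x (r / (2 * (Rabs a + 1)))) as [O [OO [Ox HO]]]; [apply Rdiv_lt_0_compat; lra |].
  destruct (Hg x (r / 2)) as [O' [OO' [Ox' HO']]]; [lra |].
  exists (fun y => O y /\ O' y). split; [now apply open_inter |]. split; [now split |].
  intros y [Oy Oy']. specialize (HO y Oy). specialize (HO' y Oy').
  replace (a * f y + g y - (a * f x + g x)) with (a * (f y - f x) + (g y - g x)) by ring.
  eapply Rle_lt_trans; [apply Rabs_triang |]. rewrite Rabs_mult.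
  pose proof (Rmult_le_compat_l _ _ _ Pa (Rlt_le _ _ HO)) as H.
  assert (0 < r / (2 * (Rabs a + 1))) by (apply Rdiv_lt_0_compat; lra).
  assert (r / 2 = (Rabs a + 1) * (r / (2 * (Rabs a + 1)))) by (field; lra). lra.
Qed.

Lemma real_continuous_lsum (K : Top) (T : Type) (f : T -> K -> R) (a : T -> R) (l : list T) :
  (forall t, real_continuous K (f t)) ->
  real_continuous K (fun x => lsum T (fun t => f t x * a t) l).
Proof.
  intros Hf. induction l as [| t l IH]; simpl; [apply real_continuous_const |].
  replace (fun x => f t x * a t + lsum T (fun t => f t x * a t) l) with
    (fun x => a t * f t x + lsum T (fun t => f t x * a t) l).
  - now apply real_continuous_lin.
  - apply functional_extensionality. intros x. ring.
Qed.

(* A continuous injection of [K] into the unit ball of [l2 T] is weakly continuous as soon as its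
   coordinates are continuous. *)
Definition ball_coordinates (K : Top) (T : Type) (f : T -> K -> R) : Prop :=
  (forall t, real_continuous K (f t)) /\
  (forall x y, x <> y -> exists t, f t x <> f t y) /\
  forall x l, NoDup l -> lsum T (fun t => f t x * f t x) l <= 1.

Lemma weak_open_coordinate (T : Type) (t : T) (c r : R) :
  weak_open (l2 T) (fun v => Rabs (proj1_sig v t - c) < r).
Proof.
  intros v Hv. exists (((fun w => proj1_sig w t), r - Rabs (proj1_sig v t - c)) :: nil). split.
  - intros p [<- | []]; simpl. split; [| lra]. split; [| split].
    + intros x y. simpl. ring.
    + intros a x. simpl. ring.
    + exists 1. intros x. rewrite Rmult_1_l. apply l2_coord.
  - intros w Hw. specialize (Hw _ (or_introl eq_refl)). simpl in Hw.
    replace (proj1_sig w t - c) with (proj1_sig w t - proj1_sig v t + (proj1_sig v t - c)) by ring.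
    eapply Rle_lt_trans; [apply Rabs_triang |]. lra.
Qed.

Lemma weak_hausdorff (T : Type) : hausdorff (weak_top (l2 T)).
Proof.
  intros x y N.
  assert (H : exists t, proj1_sig x t <> proj1_sig y t).
  { apply NNPP; intros H. apply N, (l2_ext T x y). intros t. apply NNPP; intros Nt.
    apply H. now exists t. }
  destruct H as [t Ht]. pose (r := Rabs (proj1_sig x t - proj1_sig y t) / 2).
  assert (Pr : 0 < r) by (pose proof (Rabs_pos_lt (proj1_sig x t - proj1_sig y t)); unfold r; lra).
  exists (fun v => Rabs (proj1_sig v t - proj1_sig x t) < r),
    (fun v => Rabs (proj1_sig v t - proj1_sig y t) < r).
  split; [apply weak_open_coordinate |]. split; [apply weak_open_coordinate |].
  split; [now rewrite Rminus_diag, Rabs_R0 |]. split; [now rewrite Rminus_diag, Rabs_R0 |].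
  intros v [H1 H2]. rewrite Rabs_minus_sym in H1.
  pose proof (Rabs_triang (proj1_sig x t - proj1_sig v t) (proj1_sig v t - proj1_sig y t)) as H3.
  replace (proj1_sig x t - proj1_sig v t + (proj1_sig v t - proj1_sig y t)) with
    (proj1_sig x t - proj1_sig y t) in H3 by ring. unfold r in *. lra.
Qed.

Lemma ball_coordinates_weakly_continuous (K : Top) (T : Type) (f : T -> K -> R)
  (F : K -> weak_top (l2 T)) :
  ball_coordinates K T f -> (forall x t, proj1_sig (F x) t = f t x) ->
  continuous K (weak_top (l2 T)) F.
Proof.
  intros [Hc [_ Hb]] HF V OV. apply open_nbhd. intros x Vx.
  destruct (OV (F x) Vx) as [l [Hl Sl]].
  assert (Hball : forall y, l2_inner T (F y) (F y) <= 1).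
  { intros y. apply (has_sum_le T _ _ 1 (l2_inner_sum T (F y) (F y))). intros m ND.
    rewrite (lsum_ext T _ (fun t => f t y * f t y)); [now apply Hb |].
    intros t _. now rewrite !HF. }
  assert (HO : forall p, exists O : K -> Prop, In p l ->
    open O /\ O x /\ forall y, O y -> Rabs (fst p (F y) - fst p (F x)) < snd p).
  { intros p. destruct (classic (In p l)) as [Hp | N]; [| now exists (fun _ => True)].
    destruct (Hl p Hp) as [Hphi Pr].
    (* Three errors of at most a quarter each: the finite approximation of the functional at [y] and
       at [x], and the variation of that approximation between them. *)
    destruct (bounded_linear_coordinates T (fst p) (snd p / 4) Hphi) as [m Hm]; [lra |].
    destruct (real_continuous_lsum K T f (fun t => fst p (l2_single T t)) m Hc x (snd p / 4))
      as [O [OO [Ox HO]]]; [lra |].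
    exists O. intros _. split; [exact OO |]. split; [exact Ox |]. intros y Oy.
    specialize (HO y Oy). pose proof (Hm (F y) (Hball y)) as Hy. pose proof (Hm (F x) (Hball x)) as Hx.
    rewrite (lsum_ext T _ (fun t => f t y * fst p (l2_single T t))) in Hy by
      (intros t _; now rewrite HF).
    rewrite (lsum_ext T _ (fun t => f t x * fst p (l2_single T t))) in Hx by
      (intros t _; now rewrite HF).
    revert HO Hx Hy. unfold Rabs. repeat destruct Rcase_abs; lra. }
  apply choice in HO. destruct HO as [O HO].
  exists (fun y => forall p, In p l -> O p y).
  split; [apply open_forall_list; intros p Hp; now apply HO |].
  split; [intros p Hp; now apply HO |].
  intros y Hy. apply Sl. intros p Hp. apply (HO p Hp). now apply Hy.
Qed.

(** The coordinates give a weakly continuous injection of a compact space into a Hausdorff one,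
    hence a homeomorphism onto the image. *)
Lemma ball_coordinates_uniform_eberlein (K : Top) (T : Type) (f : T -> K -> R) :
  compact K -> ball_coordinates K T f -> uniform_eberlein K.
Proof.
  intros HK Hf. pose proof Hf as [_ [Hsep Hb]].
  pose (F := fun x : K => exist _ (fun t => f t x) (ex_intro _ 1 (Hb x)) : weak_top (l2 T)).
  assert (Fcont : continuous K (weak_top (l2 T)) F).
  { now apply (ball_coordinates_weakly_continuous K T f F Hf). }
  assert (Finj : forall x y, F x = F y -> x = y).
  { intros x y E. apply NNPP; intros N. destruct (Hsep x y N) as [t Ht]. apply Ht.
    exact (equal_f (f_equal (@proj1_sig _ _) E) t). }
  set (A := fun v => exists x, F x = v).
  exists (l2 T), A.
  set (F' := fun x => exist A (F x) (ex_intro _ x eq_refl) : subspace (weak_top (l2 T)) A).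
  assert (F'cont : continuous K (subspace (weak_top (l2 T)) A) F').
  { intros V [V' [OV EV]]. eapply open_ext; [| exact (Fcont V' OV)].
    intros x; simpl. now rewrite EV. }
  assert (surj : forall v : subspace (weak_top (l2 T)) A, exists x, F' x = v).
  { intros [v [x Ex]]. exists x. now apply sig_ext. }
  split.
  - intros I U OU Hcov. destruct (HK I (fun i x => U i (F' x))) as [l Hl].
    + intros i. exact (F'cont (U i) (OU i)).
    + intros x. apply Hcov.
    + exists l. intros v. destruct (surj v) as [x <-]. apply Hl.
  - destruct (choice _ surj) as [G HG]. exists F', G.
    assert (HGF : forall x, G (F' x) = x).
    { intros x. apply Finj. exact (f_equal (@proj1_sig _ _) (HG (F' x))). }
    split; [exact F'cont |]. split; [| now split].
    (* The inverse is continuous because [F'] maps closed subsets of the compact space [K] to closed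
       sets. *)
    intros V OV.
    assert (CV : closed K (fun x => ~ V x)).
    { eapply open_ext; [| exact OV]. intros x; split; [tauto | apply NNPP]. }
    pose proof (compact_image_closed (subspace K (fun x => ~ V x)) (subspace (weak_top (l2 T)) A)
      (fun x => F' (proj1_sig x)) (subspace_closed_compact K _ HK CV)
      (subspace_hausdorff _ A (weak_hausdorff T))) as H.
    eapply open_ext; [| apply H].
    + intros v. split.
      * intros N. apply NNPP; intros NV. apply N. exists (exist _ (G v) NV). apply HG.
      * intros Vv [[x Nx] <-]. apply Nx. now rewrite <- (HGF x).
    + intros W OW. exists (fun x => W (F' x)). split; [exact (F'cont W OW) | easy].
Qed.

(* The coordinates of the summand [K i], halved, together with half its indicator function. *)
Lemma sum_extension_ball_coordinates (I : Type) (K : I -> Top) (X : Top) (e : top_sum I K -> X) :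
  compact X -> hausdorff X -> embedding (top_sum I K) X e -> (forall i, compact (K i)) ->
  (forall p q : X, (forall s, e s <> p) -> (forall s, e s <> q) -> p = q) ->
  (forall i, exists (T : Type) f, ball_coordinates (K i) T f) ->
  exists (T : Type) f, ball_coordinates X T f.
Proof.
  intros C T2 He HK Hrem HT.
  apply dep_choice in HT. destruct HT as [T HT]. apply dep_choice in HT. destruct HT as [f Hf].
  assert (einj : forall i j k k', e (sum_in I K i k) = e (sum_in I K j k') -> i = j).
  { intros i j k k' E. apply He in E. exact (f_equal (@projT1 _ _) E). }
  assert (einj' : forall i k k', e (sum_in I K i k) = e (sum_in I K i k') -> k = k').
  { intros i k k' E. apply He in E. now apply sum_in_inj in E. }
  set (val := fun i (o : option (T i)) k =>
    match o with Some t => / 2 * f i t k | None => / 2 end).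
  assert (Hh : forall tx : {i : I & option (T i)} * X, exists r : R,
    (forall k, e (sum_in I K (projT1 (fst tx)) k) = snd tx ->
      r = val (projT1 (fst tx)) (projT2 (fst tx)) k) /\
    ((forall k, e (sum_in I K (projT1 (fst tx)) k) <> snd tx) -> r = 0)).
  { intros [[i o] x]; simpl. destruct (classic (exists k, e (sum_in I K i k) = x)) as [[k <-] | N].
    - exists (val i o k). split.
      + intros k' E. apply einj' in E. now subst.
      + intros N. now destruct (N k).
    - exists 0. split; [| reflexivity]. intros k E. destruct N. now exists k. }
  apply choice in Hh. destruct Hh as [h' Hh].
  exists {i : I & option (T i)}, (fun t x => h' (t, x)).
  set (h := fun t x => h' (t, x)).
  assert (h_in : forall i o k, h (existT _ i o) (e (sum_in I K i k)) = val i o k).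
  { intros i o k. now apply (Hh (existT _ i o, e (sum_in I K i k))). }
  assert (h_out : forall i o x, (forall k, e (sum_in I K i k) <> x) -> h (existT _ i o) x = 0).
  { intros i o x N. now apply (Hh (existT _ i o, x)). }
  clearbody h. clear h' Hh.
  assert (h_other : forall i j o k, i <> j -> h (existT _ j o) (e (sum_in I K i k)) = 0).
  { intros i j o k N. apply h_out. intros k' E. apply N. symmetry. exact (einj _ _ _ _ E). }
  split; [| split].
  - intros [i o] x r Hr. destruct (classic (exists k, e (sum_in I K i k) = x)) as [[k <-] | N].
    + assert (H : real_continuous (K i) (val i o)).
      { destruct o as [t |]; [| apply real_continuous_const].
        replace (val i (Some t)) with (fun k => / 2 * f i t k + 0).
        - apply real_continuous_lin; [apply Hf | apply real_continuous_const].
        - apply functional_extensionality. intros y. simpl. ring. }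
      destruct (H k r Hr) as [O [OO [Ok HO]]].
      exists (fun x => exists s, (exists k, O k /\ s = sum_in I K i k) /\ e s = x).
      split; [now apply (sum_image_open I K X e T2 He Hrem), sum_in_open |].
      split; [exists (sum_in I K i k); split; [now exists k | reflexivity] |].
      intros y [s [[k' [Ok' ->]] <-]]. rewrite !h_in. now apply HO.
    + exists (fun x => ~ exists k, e (sum_in I K i k) = x).
      split; [apply (summand_clopen I K X e T2 He HK Hrem) |]. split; [exact N |].
      intros y Ny. rewrite !h_out; [now rewrite Rminus_diag, Rabs_R0 | |].
      * intros k E. apply N. now exists k.
      * intros k E. apply Ny. now exists k.
  - assert (H : forall x y i k, e (sum_in I K i k) = x -> x <> y -> exists t, h t x <> h t y).
    { intros x y i k <- Nxy.
      destruct (classic (exists k', e (sum_in I K i k') = y)) as [[k' <-] | N].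
      - destruct (Hf i) as [_ [Hsep _]]. destruct (Hsep k k') as [t Ht]; [now intros -> |].
        exists (existT _ i (Some t)). rewrite !h_in. simpl. lra.
      (* The indicator coordinate separates a summand from everything outside it, including the
         remainder point. *)
      - exists (existT _ i None). rewrite h_in, h_out; [simpl; lra |].
        intros k' E. apply N. now exists k'. }
    intros x y N. destruct (classic (exists s, e s = x)) as [[[i k] E] | Nx].
    + exact (H x y i k E N).
    + destruct (classic (exists s, e s = y)) as [[[i k] E] | Ny].
      * destruct (H y x i k E (not_eq_sym N)) as [t Ht]. exists t. now apply not_eq_sym.
      * destruct N. apply Hrem; intros s E; [apply Nx | apply Ny]; now exists s.
  - intros x l ND. destruct (classic (exists s, e s = x)) as [[[i k] E] | N].
    + change (e (sum_in I K i k) = x) in E. subst x. set (x := e (sum_in I K i k)).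
      (* Only coordinates of the summand of [x] contribute: [m] lists the halved ones, and the
         indicator, occurring at most once, adds a quarter. The sharper bound in its absence is what
         carries the induction past it; the total is at most 1/2. *)
      assert (H : exists m, NoDup m /\ (forall t, In t m -> In (existT _ i (Some t)) l) /\
        lsum _ (fun t => h t x * h t x) l <= / 4 * lsum (T i) (fun t => f i t k * f i t k) m + / 4 /\
        (~ In (existT _ i None) l ->
          lsum _ (fun t => h t x * h t x) l <= / 4 * lsum (T i) (fun t => f i t k * f i t k) m)).
      { induction l as [| [j o] l IH].
        { exists nil. split; [constructor |]. simpl. split; [easy |]. split; lra. }
        inversion ND as [| ? ? Nt ND']; subst. destruct (IH ND') as [m [NDm [Im [H1 H2]]]].
        destruct (classic (i = j)) as [<- | Nij].
        - unfold x. simpl. rewrite h_in. fold x. destruct o as [t |].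
          + exists (t :: m). split; [constructor; [intros Ht; now apply Nt, Im | exact NDm] |].
            split; [intros t' [-> | Ht']; [now left | right; now apply Im] |]. simpl.
            split; [lra |]. intros NN. assert (~ In (existT _ i None) l) by tauto.
            specialize (H2 H). lra.
          + exists m. split; [exact NDm |]. split; [intros t Ht; right; now apply Im |].
            specialize (H2 Nt). simpl. split; [lra |]. intros NN. destruct NN. now left.
        - exists m. split; [exact NDm |]. split; [intros t Ht; right; now apply Im |].
          unfold x. simpl. rewrite (h_other i j o k Nij). fold x. split; [lra |].
          intros NN. assert (~ In (existT _ i None) l) by tauto. specialize (H2 H). lra. }
      destruct H as [m [NDm [_ [H1 _]]]]. pose proof (proj2 (proj2 (Hf i)) k m NDm). lra.
    + rewrite (lsum_ext _ _ (fun _ => 0)); [rewrite lsum_zero; lra |].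
      intros [j o] _. rewrite h_out; [ring |]. intros k E. apply N. now exists (sum_in I K j k).
Qed.

Lemma classA_uniform_eberlein (X : Top) : classA X -> uniform_eberlein X.
Proof.
  intros HX.
  assert (H : exists (T : Type) f, ball_coordinates X T f).
  { induction HX as [X N | X [x Hx] | I K HA IH X e [[C [T2 [He _]]] Hrem]].
    - exists False, (fun _ _ => 0). split; [easy |]. split; [intros x; destruct (N x) |].
      intros x; destruct (N x).
    - exists False, (fun _ _ => 0). split; [easy |]. split.
      + intros y z Nyz. destruct Nyz. now rewrite (Hx y), (Hx z).
      + intros y [| [] l] _. simpl. lra.
    - apply (sum_extension_ball_coordinates I K X e C T2 He); auto.
      intros i. apply classA_compact_hausdorff, HA. }
  destruct H as [T [f Hf]].
  apply (ball_coordinates_uniform_eberlein X T f); [now apply classA_compact_hausdorff | exact Hf].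
Qed.

Theorem theorem3 :
  (forall X : Top, scattered X -> metrizable X ->
     exists (K : Top) (e : X -> K),
       compactification X K e /\ scattered K /\ hereditarily_paracompact K) /\
  (forall K : Top, compact K -> hausdorff K -> scattered K ->
     hereditarily_paracompact K -> uniform_eberlein K) /\
  (forall X : Top, compact X -> hausdorff X ->
     (scattered X /\ hereditarily_paracompact X <-> classA X)).
Proof.
  split; [exact scattered_metrizable_compactification |]. split.
  - intros K C T2 S HP. apply classA_uniform_eberlein.
    now apply scattered_hereditarily_paracompact_classA.
  - intros X C T2. split.
    + intros [S HP]. now apply scattered_hereditarily_paracompact_classA.
    + apply classA_scattered_hereditarily_paracompact.
Qed.
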